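(* Consider the undirected decoupled multiplicative $\alpha$-spanner problem. Let $E^{>}=E\setminus E[\hat w]$ be the set of high-weight edges, where $\hat w$ is the final threshold computed by AugmentedGreedy. (i) For $\alpha=2k-1$, $k\in\mathbb{N}_{\ge1}$, AugmentedGreedy yields a spanner $H$ whose size $|E(H)|$ and whose weight ratio $w(H)/\mathrm{OPT}$ are both in $\mathcal{O}\big(n^{1+1/k}+\sqrt n\,|E^{>}|\big)$. (ii) In the geometric setting, for $\alpha>1$, this improves to $\mathcal{O}\big(n+\sqrt n\,|E^{>}|\big)$ for both the size and the weight ratio.
   Context: Undirected decoupled multiplicative $\alpha$-spanner problem: given a connected simple undirected graph $G=(V,E)$ with $n$ nodes, weights $w\colon E\to\mathbb{Q}_{\ge0}$ and lengths $\ell\colon E\to\mathbb{Q}_{>0}$ (independent of each other), find a minimum-weight subgraph $H=(V,E')$, $E'\subseteq E$, with $d_H^\ell(u,v)\le\delta(u,v):=\alpha\cdot d_G^\ell(u,v)$ for all node pairs (such an $H$ is called a feasible spanner), where $d^\ell$ is shortest-path distance w.r.t. $\ell$. $w(H)=\sum_{e\in E'}w(e)$; $\mathrm{OPT}$ is the minimum weight of a feasible spanner. It suffices to enforce the demands for the metric edges $M\subseteq E$, i.e. the edges $e=\{u,v\}$ with $d^\ell_{G-e}(u,v)>\ell(e)$ (the edge is the unique shortest path between its endpoints); the algorithm is run with terminal pairs $K=M$. Geometric setting: $G$ is a complete graph with Euclidean lengths (values may then be real numbers); weights remain independent of lengths. Greedy$(G,K,\ell,\delta)$: start with $H=(V,\emptyset)$;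 process the pairs $(u,v)\in K$ in non-decreasing order of $d_G^\ell(u,v)$; if $d_H^\ell(u,v)>\delta(u,v)$ for the current $H$, add to $H$ the shortest $uv$-path of $G$ w.r.t. $\ell$, where ties are broken consistently so that shortest paths are unique (e.g. by a well-chosen perturbation or lexicographic ordering). Return $H$. AugmentedGreedy$(G,K,w,\ell,\delta)$: let $\mathcal W=\{w(e):e\in E\}$, $E[w']=\{e\in E:w(e)\le w'\}$, $G[w']=(V,E[w'])$. (1) Determine $\hat w=\min\{w'\in\mathcal W:G[w']\text{ is a feasible spanner}\}$. (2) Set $\hat w\leftarrow\max\{\hat w,w(\mathit{MST}(G,w))\}$, where $\mathit{MST}(G,w)$ is a minimum-weight spanning tree of $G$. (3) Return Greedy$(G[\hat w],K,\ell,\delta)$ (with $\delta$ unchanged, i.e. defined via distances in the original $G$). *)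

(* Defs.v *)
From HB Require Import structures.
From mathcomp Require Export all_boot all_order all_algebra.
From mathcomp Require Export all_classical all_reals all_analysis.

Set Implicit Arguments.
Unset Strict Implicit.
Unset Printing Implicit Defensive.

Import Order.TTheory GRing.Theory Num.Theory.
Local Open Scope ring_scope.

(* An undirected simple graph on a finite type V is given by
   its set E of edges, each edge being a two-element subset of V. Weights and
   lengths are functions on {set V}; only their values on E matter. *)

Section Graphs.
Variable V : finType.
Implicit Types (E H T : {set {set V}}) (u v : V) (p : seq V).

Definition simple_graph E : bool := [forall e in E, #|e| == 2].

Definition adj E : rel V := fun u v => [set u; v] \in E.

Definition connected_graph E : bool :=
  [forall u, forall v, connect (adj E) u v].

Definition acyclic E : Prop :=
  forall c : seq V, ucycle (adj E) c -> (size c <= 2)%N.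

Definition spanning_tree E T : Prop :=
  [/\ T \subset E, connected_graph T & acyclic T].

(* As for MathComp's [path], a path from u is given by u and the sequence p of
   the vertices that follow u. *)
Definition simple_path E u v p : bool :=
  [&& path (adj E) u p, last u p == v & uniq (u :: p)].

Definition path_edges u p : seq {set V} :=
  pairmap (fun x y => [set x; y]) u p.

End Graphs.

Section Spanners.
Variables (F : realFieldType) (V : finType).
Implicit Types (E H K T : {set {set V}}) (u v : V) (w l : {set V} -> F).
Implicit Types (delta : V -> V -> \bar F) (pi : V -> V -> seq V).

Definition spanner_instance E w l : Prop :=
  [/\ simple_graph E, connected_graph E,
      forall e, e \in E -> 0 <= w e
    & forall e, e \in E -> 0 < l e].

Definition weight w H : F := \sum_(e in H) w e.

Definition path_length l u (p : seq V) : F := \sum_(e <- path_edges u p) l e.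

(* A simple path has fewer than #|V| vertices after its first one, so all of
   them occur in the finite type of sequences of size at most #|V|. The value
   is +oo when H has no path from u to v. *)
Definition dist l H u v : \bar F :=
  \big[Order.min/+oo%E]_(p : #|V|.-bseq V | simple_path H u v p)
     (path_length l u p)%:E.

Definition mult_demand E l (alpha : F) : V -> V -> \bar F :=
  fun u v => (alpha%:E * dist l E u v)%E.

Definition feasible E l delta H : bool :=
  (H \subset E) && [forall u, forall v, (dist l H u v <= delta u v)%E].

(* [arg min] needs E itself to be feasible, which holds for
   delta = mult_demand E l alpha with alpha >= 1. *)
Definition OPT E w l delta : F :=
  weight w [arg min_(H < E | feasible E l delta H) weight w H]%O.

Definition metric_edges E l : {set {set V}} :=
  [set e in E | [forall u, forall v,
     (e == [set u; v]) ==> ((l e)%:E < dist l (E :\ e) u v)%E]].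

(* Consistent tie-breaking: pi selects one shortest path for each connected
   pair, independently of the orientation, and each contiguous piece of a
   selected path is the selected path between its own endpoints. *)
Definition tie_breaking l E pi : Prop :=
  [/\ forall u v, connect (adj E) u v ->
        simple_path E u v (pi u v) /\
        (path_length l u (pi u v))%:E = dist l E u v,
      forall u v, connect (adj E) u v ->
        v :: pi v u = rev (u :: pi u v)
    & forall u v x (s1 s s2 : seq V), connect (adj E) u v ->
        u :: pi u v = s1 ++ (x :: s) ++ s2 -> pi x (last x s) = s].

(* Each terminal pair is listed once, in either orientation. *)
Definition processing_order E K l (s : seq (V * V)) : Prop :=
  perm_eq [seq [set q.1; q.2] | q <- s] (enum K) /\
  sorted (fun q q' : V * V => (dist l E q.1 q.2 <= dist l E q'.1 q'.2)%E) s.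

Definition greedy_step l delta pi H (q : V * V) : {set {set V}} :=
  if (delta q.1 q.2 < dist l H q.1 q.2)%E
  then H :|: [set e in path_edges q.1 (pi q.1 q.2)] else H.

(* [greedy] and [augmented_greedy] are relations: the output depends on how
   ties are broken among shortest paths and in the processing order. *)
Definition greedy E K l delta H : Prop :=
  exists pi s,
    [/\ tie_breaking l E pi, processing_order E K l s
      & H = foldl (greedy_step l delta pi) finset.set0 s].

Definition edges_le E w (x : F) : {set {set V}} := [set e in E | w e <= x].

Definition min_feasible_threshold E w l delta (x : F) : Prop :=
  [/\ exists2 e, e \in E & w e = x,
      feasible E l delta (edges_le E w x)
    & forall e, e \in E -> feasible E l delta (edges_le E w (w e)) ->
        x <= w e].

Definition minimum_spanning_tree E w T : Prop :=
  spanning_tree E T /\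
  forall T', spanning_tree E T' -> weight w T <= weight w T'.

Definition augmented_greedy E K w l delta (what : F) H : Prop :=
  exists x T,
    [/\ min_feasible_threshold E w l delta x,
        minimum_spanning_tree E w T,
        what = Order.max x (weight w T)
      & greedy (edges_le E w what) K l delta H].

Definition heavy_edges E w (what : F) : {set {set V}} :=
  E :\: edges_le E w what.

End Spanners.

(* The norm that the library puts on row vectors is the sup norm. *)
Definition euclid_dist (R : realType) (d : nat) (x y : 'rV[R]_d) : R :=
  Num.sqrt (\sum_(i < d) (x ord0 i - y ord0 i) ^+ 2).

Definition geometric_instance (R : realType) (d : nat) (V : finType)
    (pt : V -> 'rV[R]_d) (E : {set {set V}}) (l : {set V} -> R) : Prop :=
  E = [set e : {set V} | #|e| == 2] /\
  forall u v : V, u != v -> l [set u; v] = euclid_dist (pt u) (pt v).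

(* Main.v *)
From mathcomp Require Import ring lra.
Require Import Defs.

(** Since the threshold bounds the weight of every edge of H and is at most OPT,
    the weight ratio is bounded by |H|.  A light metric edge is the unique
    shortest path between its ends, so the light pairs contribute single edges:
    the last edge added to a cycle of at most 2k of them would not have been
    needed, and the Moore bound applies.  In Euclidean space, two of them with close
    respective ends would contradict the stretch already guaranteed for the
    shorter pairs; charging each edge to a point of a nested family of nets at
    the scale of its length leaves boundedly many edges per point.  The heavy
    pairs contribute |E^>| consistently tie-broken shortest paths, any two of
    which diverge at most once, so that their union has
    O(n + sqrt n |E^>|) edges (Coppersmith and Elkin). *)

Set Implicit Arguments.
Unset Strict Implicit.
Unset Printing Implicit Defensive.

Import Order.TTheory GRing.Theory Num.Theory.
Local Open Scope ring_scope.

(** * Walks and distances *)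

(** The threshold is at most OPT for two reasons: the heaviest edge of any feasible spanner is
    itself a candidate threshold, and a feasible spanner is connected, so it contains a spanning
    tree. The obstacle is that the greedy run takes place in [E' = edges_le E w what], while demands
    and metric edges refer to [E]. A heavy metric edge is missing from [E']: its pair may bring in a
    path of many edges, and is scheduled by a distance in [E'] that can exceed the length of the
    edge. For a light pair this distance still equals the length of the edge, and the girth argument
    compares light pairs only. The geometric argument needs more: all metric pairs of tiny length,
    heavy ones included, must be served before a given light pair. Feasibility of [E'] keeps their
    distance in [E'] within a factor [alpha] of their length, and the closeness parameter [eps] is
    chosen small enough to absorb this factor. *)

Section Walks.
Variable V : finType.
Implicit Types (E H : {set {set V}}) (u v : V) (p : seq V).

Lemma adj_sym H : symmetric (adj H).
Proof. by move=> u v; rewrite /adj finset.setUC. Qed.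

Lemma path_adjE H u p : path (adj H) u p = all (mem H) (path_edges u p).
Proof. by elim: p u => //= v p IHp u; rewrite IHp. Qed.

Lemma path_adj_mono H H' u p :
  H \subset H' -> path (adj H) u p -> path (adj H') u p.
Proof.
by move=> /fintype.subsetP sHH'; apply: sub_path => x y; apply: sHH'.
Qed.

Lemma path_edges_rev u p :
  path_edges (last u p) (rev (belast u p)) = rev (path_edges u p).
Proof.
elim: p u => //= v p IHp u; rewrite !rev_cons /path_edges -cats1 pairmap_cat.
rewrite -!/(path_edges _ _) IHp -cats1; congr (_ ++ _).
by case: p {IHp} => [|w p] /=; rewrite ?rev_cons ?last_rcons finset.setUC.
Qed.

Lemma path_rev H u p :
  path (adj H) u p -> path (adj H) (last u p) (rev (belast u p)).
Proof. by rewrite !path_adjE path_edges_rev all_rev. Qed.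

Lemma last_rev_belast u p : last (last u p) (rev (belast u p)) = u.
Proof. by case: p => //= v p; rewrite rev_cons last_rcons. Qed.

Lemma path_edgesP (e : {set V}) u p :
  reflect (exists s1 x y s2, u :: p = s1 ++ x :: y :: s2 /\ e = [set x; y])
          (e \in path_edges u p).
Proof.
apply: (iffP idP).
  elim: p u => //= v p IHp u; rewrite in_cons => /orP[/eqP->|/IHp].
    by exists [::], u, v, p.
  by move=> [s1 [x [y [s2 [-> ->]]]]]; exists (u :: s1), x, y, s2.
move=> [s1 [x [y [s2 [eup ->]]]]]; case: s1 eup => [|a s1] [-> ->].
  by rewrite /= in_cons eqxx.
by rewrite /path_edges pairmap_cat mem_cat /= !in_cons eqxx !orbT.
Qed.

Lemma set2_eq (a b c d : V) : [set a; b] = [set c; d] ->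
  (a = c /\ b = d) \/ (a = d /\ b = c).
Proof.
move=> e.
have /finset.set2P A : a \in [set c; d] by rewrite -e finset.set21.
have /finset.set2P B : b \in [set c; d] by rewrite -e finset.set22.
have /finset.set2P C : c \in [set a; b] by rewrite e finset.set21.
have /finset.set2P D : d \in [set a; b] by rewrite e finset.set22.
by case: A => ?; case: B => ?; case: C => ?; case: D => ?; subst; auto.
Qed.

Lemma closing_edge_notin x y z p : uniq [:: x, y, z & p] ->
  [set x; last z p] \notin path_edges x [:: y, z & p].
Proof.
move=> ux; apply/negP => /path_edgesP[s1 [a [b [s2 [e ab]]]]].
case: s1 e => [[xa yb _]|x' s1 [xx' e]].
  move: ab; rewrite -xa -yb => /set2_eq[[_ yl]|[xy _]].
    by move: ux => /= /and3P[_ + _]; rewrite -yl mem_last.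
  by move: ux => /= /andP[+ _]; rewrite xy in_cons eqxx.
move: ux; rewrite cons_uniq e mem_cat negb_or => /andP[/andP[_ + _]].
by rewrite !in_cons; case: (set2_eq ab) => -[-> _]; rewrite eqxx ?orbT.
Qed.

Lemma simple_path_size H u v p : simple_path H u v p -> (size p < #|V|)%N.
Proof.
by case/and3P=> _ _ /card_uniqP; rewrite /= => <-; apply: max_card.
Qed.

Lemma adj_neq E u v : simple_graph E -> adj E u v -> u != v.
Proof.
move=> /fintype.forall_inP sE /sE; apply: contraTneq => ->.
by rewrite finset.setUid cards1.
Qed.

Lemma connect_path H u v :
  connect (adj H) u v -> exists p, simple_path H u v p.
Proof.
case/connectP=> p /shortenP[q up uq _ ->]; exists q.
by rewrite /simple_path up uq eqxx.
Qed.

End Walks.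

Section Distances.
Variables (F : realFieldType) (V : finType) (l : {set V} -> F).
Implicit Types (E H : {set {set V}}) (u v : V) (p : seq V).

Lemma path_length_cons u v p :
  path_length l u (v :: p) = l [set u; v] + path_length l v p.
Proof. by rewrite /path_length /= big_cons. Qed.

Lemma path_length_cat u p q :
  path_length l u (p ++ q) = path_length l u p + path_length l (last u p) q.
Proof. by rewrite /path_length /path_edges pairmap_cat big_cat. Qed.

Lemma path_length_rev u p :
  path_length l (last u p) (rev (belast u p)) = path_length l u p.
Proof. by rewrite /path_length path_edges_rev big_rev. Qed.

Section PositiveLengths.
Variable H : {set {set V}}.
Hypothesis l_gt0 : forall e, e \in H -> 0 < l e.

Lemma path_length_ge0 u p : path (adj H) u p -> 0 <= path_length l u p.
Proof.
rewrite path_adjE => /allP pH; rewrite /path_length big_seq sumr_ge0// => e eP.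
by apply/ltW/l_gt0/pH.
Qed.

Lemma path_length_gt_edge u p (e : {set V}) : path (adj H) u p ->
  e \in path_edges u p -> (2 <= size p)%N -> l e < path_length l u p.
Proof.
move=> up ep szp; rewrite /path_length (perm_big _ (perm_to_rem ep)) big_cons /=.
rewrite ltrDl; have := size_rem ep; rewrite size_pairmap.
have : all (mem H) (rem e (path_edges u p)).
  move: up; rewrite path_adjE => /allP pH.
  by apply/allP => f /mem_rem /pH.
case: (rem _ _) => [_ /=|f s /= /andP[fH sH] _]; first by case: (size p) szp => [|[]].
rewrite big_cons ltr_wpDr// ?l_gt0// big_seq sumr_ge0// => g gs.
by apply/ltW/l_gt0/(allP sH).
Qed.

Lemma path_length_ge_edge u p (e : {set V}) : path (adj H) u p ->
  e \in path_edges u p -> l e <= path_length l u p.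
Proof.
case: p => [//|v [|w p]] up ep; last exact/ltW/path_length_gt_edge.
move: ep; rewrite /= inE => /eqP->.
by rewrite path_length_cons /path_length big_nil addr0.
Qed.

Lemma walk_shorten u p : path (adj H) u p -> exists2 q,
  simple_path H u (last u p) q & path_length l u q <= path_length l u p.
Proof.
elim: p u => [|v p IHp] u /=; first by exists [::]; rewrite /simple_path //= eqxx.
move=> /andP[uv /IHp[q /and3P[vq /eqP lq uq] ql]].
have [uvq|uvq] := boolP (u \in v :: q); last first.
  exists (v :: q); first by rewrite /simple_path /= uv vq -lq eqxx /= uvq.
  by rewrite !path_length_cons lerD2l.
have : 0 <= l [set u; v] by rewrite ltW// l_gt0.
rewrite path_length_cons => lge0; case/path.splitPl: q / uvq vq lq uq ql => q1 q2 lq1.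
rewrite -cat_cons cat_path last_cat cat_uniq lq1 => /andP[q1H q2H] lq.
move=> /and3P[_ dq uq2] ql.
exists q2.
  rewrite /simple_path q2H lq eqxx /= uq2 andbT.
  apply: contra dq => uq2'; apply/hasP; exists u => //; rewrite -lq1.
  exact: mem_last.
apply: le_trans (_ : path_length l v (q1 ++ q2) <= _).
  by rewrite path_length_cat lq1 lerDr path_length_ge0.
by rewrite (le_trans ql)// lerDr.
Qed.

End PositiveLengths.

Lemma dist_le_simple H u v p :
  simple_path H u v p -> (dist l H u v <= (path_length l u p)%:E)%E.
Proof.
move=> sp; have szp := ltnW (simple_path_size sp).
exact: (@bigmin_le_cond _ _ _ _ (Bseq szp)).
Qed.

Lemma dist_leP H u v (x : F) : (dist l H u v <= x%:E)%E ->
  exists2 p, simple_path H u v p & path_length l u p <= x.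
Proof. by case/bigmin_leP => // -[p up]; rewrite lee_fin; exists p. Qed.

Lemma dist_ltP H u v (x : \bar F) : (dist l H u v < x)%E ->
  exists2 p, simple_path H u v p & ((path_length l u p)%:E < x)%E.
Proof.
move=> dx; have [[p sp px]|np] := pselect (exists2 p, simple_path H u v p &
    ((path_length l u p)%:E < x)%E); first by exists p.
suff : (x <= dist l H u v)%E by rewrite leNgt dx.
apply: le_bigmin => [|p sp]; first exact: leey.
by rewrite leNgt; apply/negP => px; apply: np; exists p.
Qed.

Lemma dist_connect H u v : connect (adj H) u v ->
  exists2 p, simple_path H u v p & dist l H u v = (path_length l u p)%:E.
Proof.
move=> /connect_path[p0 sp0].
case: (@eq_bigmin _ _ _ +oo%E (Bseq (ltnW (simple_path_size sp0)))
   (fun p : #|V|.-bseq V => simple_path H u v p)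
   (fun p : #|V|.-bseq V => (path_length l u p)%:E)) => //[p _|p sp dp].
  exact: leey.
by exists p.
Qed.

Lemma dist_mono H H' u v :
  H \subset H' -> (dist l H' u v <= dist l H u v)%E.
Proof.
move=> sHH'; apply: le_bigmin => [|p /and3P[up lp uq]]; first exact: leey.
by apply: dist_le_simple; rewrite /simple_path (path_adj_mono sHH' up) lp uq.
Qed.

Lemma dist_le_walk H u p : (forall e, e \in H -> 0 < l e) ->
  path (adj H) u p -> (dist l H u (last u p) <= (path_length l u p)%:E)%E.
Proof.
move=> l0 /(walk_shorten l0)[q sq ql].
by apply: le_trans (dist_le_simple sq) _; rewrite lee_fin.
Qed.

Lemma dist_le_trans H u v z (x y : F) : (forall e, e \in H -> 0 < l e) ->
  (dist l H u v <= x%:E)%E -> (dist l H v z <= y%:E)%E ->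
  (dist l H u z <= (x + y)%:E)%E.
Proof.
move=> l0 /dist_leP[p /and3P[up /eqP lp _] px] /dist_leP[q /and3P[vq /eqP lq _] qy].
rewrite -lq -lp -last_cat.
apply: le_trans (@dist_le_walk H u (p ++ q) l0 _) _.
  by rewrite cat_path up lp.
by rewrite lee_fin path_length_cat lp lerD.
Qed.

Lemma dist_sym_le H u v (x : F) : (forall e, e \in H -> 0 < l e) ->
  (dist l H u v <= x%:E)%E -> (dist l H v u <= x%:E)%E.
Proof.
move=> l0 /dist_leP[p /and3P[up /eqP lp _] px].
have := dist_le_walk l0 (path_rev up).
rewrite path_length_rev last_rev_belast lp => /le_trans; apply.
by rewrite lee_fin.
Qed.

Lemma dist_set2_le H u v x y (t : F) : (forall e, e \in H -> 0 < l e) ->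
  [set u; v] = [set x; y] ->
  (dist l H x y <= t%:E)%E -> (dist l H u v <= t%:E)%E.
Proof. by move=> l0 /set2_eq[] [-> ->] //; apply: dist_sym_le. Qed.

Lemma dist_le0 H u (x : F) : 0 <= x -> (dist l H u u <= x%:E)%E.
Proof.
move=> x0; have sp : simple_path H u u [::] by rewrite /simple_path /= eqxx.
by apply: le_trans (dist_le_simple sp) _; rewrite /path_length big_nil lee_fin.
Qed.

Lemma dist_edge_le H u v : u != v -> [set u; v] \in H ->
  (dist l H u v <= (l [set u; v])%:E)%E.
Proof.
move=> uv uvH; have sp : simple_path H u v [:: v].
  by rewrite /simple_path /= /adj uvH eqxx inE uv.
apply: le_trans (dist_le_simple sp) _.
by rewrite path_length_cons /path_length big_nil addr0.
Qed.

End Distances.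

(** * Metric edges, feasibility and the lower bound on OPT *)

Section MetricEdges.
Variables (F : realFieldType) (V : finType) (E : {set {set V}}).
Variable l : {set V} -> F.
Hypotheses (simpleE : simple_graph E) (l_gt0 : forall e, e \in E -> 0 < l e).
Implicit Types (H : {set {set V}}) (u v : V) (p : seq V).

Lemma subset_l_gt0 H : H \subset E -> forall e, e \in H -> 0 < l e.
Proof. by move=> /fintype.subsetP sHE e /sHE /l_gt0. Qed.

Lemma metric_edge_in u v : [set u; v] \in metric_edges E l -> [set u; v] \in E.
Proof. by rewrite finset.inE => /andP[]. Qed.

Lemma metric_edge_lt u v : [set u; v] \in metric_edges E l ->
  ((l [set u; v])%:E < dist l (E :\ [set u; v]) u v)%E.
Proof.
by rewrite finset.inE => /andP[_ /forallP/(_ u)/forallP/(_ v)]; rewrite eqxx.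
Qed.

(** A path avoiding the edge would lie in [E :\ [set u; v]], where the distance between the two ends
    exceeds the length of the edge. *)
Lemma metric_edge_on_path H u v p : [set u; v] \in metric_edges E l ->
  H \subset E -> simple_path H u v p -> path_length l u p <= l [set u; v] ->
  [set u; v] \in path_edges u p.
Proof.
move=> em sHE /and3P[up lp uq] pe; apply: contraLR (metric_edge_lt em) => ep.
rewrite -leNgt (@le_trans _ _ (path_length l u p)%:E)//.
apply: dist_le_simple; rewrite /simple_path lp uq !andbT.
rewrite path_adjE; apply/allP => f fp /=; rewrite finset.in_setD1.
rewrite (contraNneq _ ep) => [|<-//].
by apply: (fintype.subsetP sHE); move: up; rewrite path_adjE => /allP; apply.
Qed.

(** The edge itself already uses up the allowed length, and any further edge would add a positive
    amount. *)
Lemma metric_edge_path H u v p : [set u; v] \in metric_edges E l ->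
  H \subset E -> simple_path H u v p -> path_length l u p <= l [set u; v] ->
  forall f, f \in path_edges u p -> f = [set u; v].
Proof.
move=> em sHE sp pe f fp; have ep := metric_edge_on_path em sHE sp pe.
have up : path (adj H) u p by case/and3P: sp.
case: p {sp} up pe ep fp => [//|x [|y p]] up pe.
  by rewrite /= !inE => /eqP-> /eqP->.
move=> ep _; have := path_length_gt_edge (subset_l_gt0 sHE) up ep isT.
by rewrite ltNge pe.
Qed.

Lemma metric_edge_dist H u v : [set u; v] \in metric_edges E l ->
  H \subset E -> [set u; v] \in H -> dist l H u v = (l [set u; v])%:E.
Proof.
move=> em sHE eH; apply/le_anti/andP; split.
  by apply: dist_edge_le => //; apply: adj_neq simpleE (metric_edge_in em).
rewrite leNgt; apply/negP => /dist_ltP[p sp]; rewrite lte_fin => pl.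
have ep := metric_edge_on_path em sHE sp (ltW pl).
have up : path (adj H) u p by case/and3P: sp.
by have := path_length_ge_edge (subset_l_gt0 sHE) up ep; rewrite leNgt pl.
Qed.

Lemma dist_path_stretch H (alpha : F) u p : H \subset E ->
  (forall x y, [set x; y] \in path_edges u p ->
     (dist l H x y <= (alpha * l [set x; y])%:E)%E) ->
  (dist l H u (last u p) <= (alpha * path_length l u p)%:E)%E.
Proof.
move=> sHE; elim: p u => [|v p IHp] u stretch.
  by rewrite /path_length big_nil mulr0 dist_le0.
rewrite path_length_cons mulrDr /=; apply: dist_le_trans (subset_l_gt0 sHE) _ _.
  by apply: stretch; rewrite /= in_cons eqxx.
by apply: IHp => x y xy; apply: stretch; rewrite /= in_cons xy orbT.
Qed.

(* A non-metric edge is replaced by a path that is no longer and has at least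
   two edges, all of them shorter: induction on the edge length applies. *)
Lemma stretch_of_metric_edges H (alpha B : F) : H \subset E -> 0 <= alpha ->
  (forall x y, [set x; y] \in metric_edges E l -> l [set x; y] <= B ->
     (dist l H x y <= (alpha * l [set x; y])%:E)%E) ->
  forall u p, path (adj E) u p -> path_length l u p <= B ->
  (dist l H u (last u p) <= (alpha * path_length l u p)%:E)%E.
Proof.
move=> sHE alpha0 stretch.
(* Lengths in an ordered field are not well-founded, so the induction is on the number of edges
   strictly shorter than the given one. *)
have edge n x y : (#|[set f in E | (l f < l [set x; y])%R]| < n)%N ->
    [set x; y] \in E -> l [set x; y] <= B ->
    (dist l H x y <= (alpha * l [set x; y])%:E)%E.
  elim: n x y => // n IHn x y cn eE eB.
  have [em|em] := boolP ([set x; y] \in metric_edges E l); first exact: stretch.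
  move: em; rewrite finset.inE eE /= => /forallPn[a /forallPn[b]].
  rewrite negb_imply -leNgt => /andP[/eqP eab].
  move=> /dist_leP[p /and3P[ap /eqP lp _] pl].
  suff dab : (dist l H a b <= (alpha * l [set x; y])%:E)%E.
    exact: dist_set2_le (subset_l_gt0 sHE) eab dab.
  suff ind c d : [set c; d] \in path_edges a p ->
      (dist l H c d <= (alpha * l [set c; d])%:E)%E.
    by rewrite -lp (le_trans (dist_path_stretch sHE ind))// lee_fin ler_wpM2l.
  have apE : path (adj E) a p by apply: path_adj_mono ap; apply: subD1set.
  (* A single edge from [a] to [b] would be the removed one. With two edges or more, each edge of
     [p] is strictly shorter than the whole path. *)
  have szp : (2 <= size p)%N.
    have ab : a != b by apply: (adj_neq simpleE); rewrite /adj -eab.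
    case: p ap lp {apE pl} => [_ /= /eqP|z [|//] /=]; first by rewrite (negPf ab).
    by move=> + zb; rewrite zb /adj -eab finset.setD11.
  move=> cd; have cdl := path_length_gt_edge l_gt0 apE cd szp.
  have cdE : [set c; d] \in E by move: apE; rewrite path_adjE => /allP; apply.
  have cdxy := lt_le_trans cdl pl.
  apply: IHn => //; last exact: ltW (lt_le_trans cdxy eB).
  apply: leq_trans (_ : (_ < #|[set f in E | (l f < l [set x; y])%R]|)%N) cn.
  apply/proper_card/fintype.properP.
  split.
    by apply/fintype.subsetP => f; rewrite !finset.inE => /andP[-> /lt_trans->].
  by exists [set c; d]; rewrite !finset.inE cdE ?cdxy// ltxx.
move=> u p up pB; apply: dist_path_stretch => // x y xy.
have xyE : [set x; y] \in E by move: up; rewrite path_adjE => /allP; apply.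
by apply: edge => //; apply: le_trans (path_length_ge_edge l_gt0 up xy) pB.
Qed.

Lemma mult_demandE (alpha : F) u v : connected_graph E ->
  exists2 r : F, 0 <= r &
    dist l E u v = r%:E /\ mult_demand E l alpha u v = (alpha * r)%:E.
Proof.
move=> /forallP/(_ u)/forallP/(_ v)/(dist_connect l)[p /and3P[up _ _] dp].
exists (path_length l u p); first exact: (path_length_ge0 l_gt0 up).
by rewrite /mult_demand dp EFinM.
Qed.

Lemma feasible_self (alpha : F) : connected_graph E -> 1 <= alpha ->
  feasible E l (mult_demand E l alpha) E.
Proof.
move=> cE alpha1; rewrite /feasible fintype.subxx /=.
apply/forallP => u; apply/forallP => v.
have [r r0 [-> ->]] := mult_demandE alpha u v cE.
by rewrite lee_fin ler_peMl.
Qed.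

Lemma feasible_connected (alpha : F) H : connected_graph E ->
  feasible E l (mult_demand E l alpha) H -> connected_graph H.
Proof.
move=> cE /andP[_ dH]; apply/forallP => u; apply/forallP => v.
have := forallP (forallP dH u) v; have [r r0 [_ ->]] := mult_demandE alpha u v cE.
by move=> /dist_leP[p /and3P[up /eqP <- _] _]; apply/connectP; exists p.
Qed.

Lemma feasible_mono (delta : V -> V -> \bar F) H H' : H \subset H' ->
  H' \subset E -> feasible E l delta H -> feasible E l delta H'.
Proof.
move=> sHH' sHE /andP[_ dH]; rewrite /feasible sHE /=.
apply/forallP => u; apply/forallP => v.
exact: le_trans (dist_mono l u v sHH') (forallP (forallP dH u) v).
Qed.

Lemma spanner_feasible H (alpha : F) : connected_graph E -> H \subset E ->
  0 <= alpha ->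
  (forall x y, [set x; y] \in metric_edges E l ->
     (dist l H x y <= (alpha * l [set x; y])%:E)%E) ->
  feasible E l (mult_demand E l alpha) H.
Proof.
move=> cE sHE alpha0 stretch; rewrite /feasible sHE /=.
apply/forallP => u; apply/forallP => v.
have /(dist_connect l)[p /and3P[up /eqP lp _] dp] := forallP (forallP cE u) v.
rewrite /mult_demand dp -EFinM -lp.
by apply: (@stretch_of_metric_edges H alpha (path_length l u p)) => // x y /stretch.
Qed.

End MetricEdges.

(** An inclusion-minimal connected subgraph is acyclic: the closing edge of a cycle on at least
    three vertices could be dropped, its ends staying joined by the rest of the cycle. *)
Lemma exists_spanning_tree (V : finType) (E H : {set {set V}}) :
  H \subset E -> connected_graph H ->
  exists2 T : {set {set V}}, T \subset H & spanning_tree E T.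
Proof.
move=> sHE cH.
have := @finset.minset_exists _ (fun T : {set {set V}} => connected_graph T) H cH.
move=> [T /finset.minsetP[cT minT] sTH]; exists T => //; split=> //.
  exact: fintype.subset_trans sHE.
move=> c /andP[cc uc]; rewrite leqNgt; apply/negP => szc.
case: c cc uc szc => [|x [|z [|t p]]] //; set y := last t p.
have -> : cycle (adj T) [:: x, z, t & p] =
  path (adj T) x [:: z, t & p] && adj T y x by rewrite /= rcons_path !andbA.
move=> /andP[xp yx] ux _.
have xpN : path (adj (T :\ [set x; y])) x [:: z, t & p].
  rewrite path_adjE; apply/allP => f fp /=; rewrite finset.in_setD1.
  rewrite andbC; move: (xp); rewrite path_adjE => /allP/(_ _ fp) /= -> /=.
  by apply: contraTneq fp => ->; apply: closing_edge_notin.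
have cxy : connect (adj (T :\ [set x; y])) x y by apply/connectP; exists [:: z, t & p].
have sT : connected_graph (T :\ [set x; y]).
  apply/forallP => a; apply/forallP => b.
  have := forallP (forallP cT a) b; apply: connect_sub => x' y' xy'.
  have [xye|xye] := eqVneq [set x'; y'] [set x; y]; last first.
    by apply: connect1; rewrite /adj finset.in_setD1 xye.
  case: (set2_eq xye) => -[-> ->] //.
  by rewrite (sym_connect_sym (@adj_sym _ _)).
have := minT _ sT (subD1set _ _) => /finset.setP/(_ [set x; y]).
by rewrite finset.setD11 finset.setUC [in RHS](yx : [set y; x] \in T).
Qed.

Lemma weight_mono (F : realFieldType) (V : finType) (w : {set V} -> F)
    (H H' : {set {set V}}) : H \subset H' -> (forall e, e \in H' -> 0 <= w e) ->
  weight w H <= weight w H'.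
Proof.
move=> sHH' w0; rewrite /weight [leRHS](big_setID H) /= (finset.setIidPr sHH').
by rewrite lerDl sumr_ge0// => e; rewrite finset.in_setD => /andP[_ /w0].
Qed.

Section LowerBound.
Variables (F : realFieldType) (V : finType) (E : {set {set V}}).
Variables (w l : {set V} -> F) (alpha : F).
Hypotheses (inst : spanner_instance E w l) (alpha_ge1 : 1 <= alpha).
Let delta := mult_demand E l alpha.

(** If [f] is a heaviest edge of [H], then [H] lies in [edges_le E w (w f)], which is therefore
    feasible; minimality gives [x <= w f], and [w f] is one term of the weight of [H]. *)
Lemma threshold_le_weight (x : F) H :
  min_feasible_threshold E w l delta x -> feasible E l delta H ->
  x <= weight w H.
Proof.
have [sE cE w0 l0] := inst; move=> [[e0 e0E _] _ minx] fH.
have cH := feasible_connected l0 cE fH; have /andP[sHE _] := fH.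
have [f fH' fmax] : exists2 f, f \in H & forall e, e \in H -> w e <= w f.
  (* [H] is not empty, since it joins the two distinct ends of the edge at which the threshold is
     attained. *)
  suff [f0 f0H] : exists f0, f0 \in H.
    by case: (@arg_maxP _ _ _ f0 (mem H) w f0H) => f fH' fmax; exists f.
  have /cards2P[u [v [uv e0uv]]] := fintype.forall_inP sE _ e0E.
  have /connectP[[|y p]/=] := forallP (forallP cH u) v.
    by move=> _ vu; rewrite vu eqxx in uv.
  by move=> /andP[uy _] _; exists [set u; y].
have fE := fintype.subsetP sHE _ fH'.
have wf : w f <= weight w H.
  rewrite /weight (big_setD1 f fH') lerDl sumr_ge0// => e.
  by rewrite finset.in_setD1 => /andP[_ /(fintype.subsetP sHE)/w0].
apply: le_trans wf; apply: minx fE _; apply: feasible_mono fH.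
  by apply/fintype.subsetP => e eH; rewrite finset.inE fmax// (fintype.subsetP sHE).
by apply/fintype.subsetP => e; rewrite finset.inE => /andP[].
Qed.

Lemma threshold_le_OPT (x : F) T :
  min_feasible_threshold E w l delta x -> minimum_spanning_tree E w T ->
  Order.max x (weight w T) <= OPT E w l delta.
Proof.
have [sE cE w0 l0] := inst; move=> xmin [_ Tmin].
rewrite /OPT; case: arg_minP => [|H fH _]; first exact: feasible_self.
rewrite ge_max (threshold_le_weight xmin fH) /=.
have /andP[sHE _] := fH.
have [T' sT'H /Tmin wT] := exists_spanning_tree sHE (feasible_connected l0 cE fH).
apply: le_trans wT (weight_mono sT'H _) => e eH.
exact/w0/(fintype.subsetP sHE).
Qed.

Lemma weight_le_card (H : {set {set V}}) (x : F) : H \subset edges_le E w x ->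
  weight w H <= #|H|%:R * x.
Proof.
move=> sH; rewrite /weight mulr_natl -sumr_const ler_sum// => e /(fintype.subsetP sH).
by rewrite finset.inE => /andP[].
Qed.

End LowerBound.

(** * The Moore bound *)

Section MooreBound.
Local Open Scope nat_scope.
Variables (V : finType) (L : {set {set V}}) (k : nat).
Hypothesis simpleL : simple_graph L.
Hypothesis girthL :
  forall c : seq V, ucycle (adj L) c -> (size c <= 2) || (2 * k < size c).
Implicit Types (S : {set V}) (x y v : V).

Definition nbrs S x : {set V} := [set y in S | adj L x y].

(** Balls stay inside a vertex set [S] because a large minimum degree will be available only in a
    subgraph induced on some subset. *)
Fixpoint ball S v i : {set V} :=
  if i is j.+1 then
    ball S v j :|: [set y in S | [exists x in ball S v j, adj L x y]]
  else [set v].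

Definition sphere S v i : {set V} :=
  [set x in ball S v i | [forall j : 'I_i, x \notin ball S v j]].

Lemma ball_sub S v i : v \in S -> ball S v i \subset S.
Proof.
move=> vS; elim: i => [|i IHi] /=; first by rewrite finset.sub1set.
rewrite finset.subUset IHi; apply/fintype.subsetP => x.
by rewrite finset.inE => /andP[].
Qed.

Lemma ball_mono S v i j : i <= j -> ball S v i \subset ball S v j.
Proof.
move/subnKC <-; elim: (j - i) => [|m IHm]; first by rewrite addn0.
by rewrite addnS (fintype.subset_trans IHm) // finset.subsetUl.
Qed.

(** Built layer by layer, the path has all its vertices but possibly the last in balls of radius
    below [i], which miss [x]; the last one is [y], different from [x]. *)
Lemma ball_path S v i x y : (forall j, j < i -> x \notin ball S v j) ->
  y \in ball S v i -> y != x -> exists p,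
    [/\ path (adj L) v p, last v p = y, size p <= i & x \notin v :: p].
Proof.
elim: i y => [|i IHi] y xN.
  rewrite finset.in_set1 => /eqP-> vx; exists [::].
  by rewrite /= mem_seq1 eq_sym.
have IH z : z \in ball S v i -> z != x -> exists p,
    [/\ path (adj L) v p, last v p = z, size p <= i & x \notin v :: p].
  by apply: IHi => j ji; apply/xN/ltnW.
rewrite /= finset.in_setU => /orP[yi yx|].
  by have [p [vp lp sp xp]] := IH y yi yx; exists p; split=> //; apply: ltnW.
rewrite finset.inE => /andP[_ /fintype.exists_inP[z zi zy]] yx.
have zx : z != x by apply: contraNneq (xN i (ltnSn i)) => <-.
have [p [vp lp sp xp]] := IH z zi zx; exists (rcons p y).
rewrite rcons_path vp lp zy last_rcons size_rcons ltnS sp.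
by rewrite -rcons_cons mem_rcons in_cons negb_or eq_sym yx xp.
Qed.

(* Two such neighbours y, y' would lie on a cycle of length at most 2i + 2
   through x, since x is on neither of the short paths from v to y and y'. *)
Lemma ball_nbr_unique S v i x y y' : i < k ->
  (forall j, j < i -> x \notin ball S v j) ->
  y \in ball S v i -> y' \in ball S v i -> adj L x y -> adj L x y' -> y = y'.
Proof.
move=> ik xN yi y'i xy xy'; apply/eqP/negPn/negP => yy'.
have yx : y != x by rewrite eq_sym; apply: adj_neq xy.
have y'x : y' != x by rewrite eq_sym; apply: adj_neq xy'.
have [p [vp lp sp xp]] := ball_path xN yi yx.
have [q [vq lq sq xq]] := ball_path xN y'i y'x.
have : path (adj L) y (rev (belast v p) ++ q).
  by rewrite cat_path -lp path_rev // last_rev_belast.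
have : last y (rev (belast v p) ++ q) = y'.
  by rewrite last_cat -lp last_rev_belast.
have : x \notin y :: (rev (belast v p) ++ q).
  rewrite -cat_cons mem_cat negb_or; apply/andP; split.
    by rewrite -lp -rev_rcons -lastI mem_rev.
  by move: xq; rewrite in_cons negb_or => /andP[].
have : size (rev (belast v p) ++ q) <= 2 * i.
  by rewrite size_cat size_rev size_belast mul2n -addnn leq_add.
move: (rev _ ++ q) => r sr xr lr yr; case/shortenP: yr lr => r' yr' ur' sr' lr'.
have szr' : size r' <= size r by apply: uniq_leq_size => //; case/andP: ur'.
have ucc : ucycle (adj L) [:: x, y & r'].
  rewrite /ucycle /= rcons_path xy yr' lr' adj_sym xy' /=.
  move: ur' => /= ->; rewrite andbT; apply: contra xr; rewrite !in_cons.
  by case/orP => [->//|/sr'->]; rewrite orbT.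
have := girthL ucc; rewrite /= !ltnS leqn0 size_eq0 => /orP[/eqP r'0|].
  by move: lr' yy'; rewrite r'0 /= => ->; rewrite eqxx.
rewrite leqNgt => /negP; apply; apply: leq_trans (_ : (2 * i).+2 <= _).
  by rewrite !ltnS (leq_trans szr').
by rewrite -addn2 addnC -mulnS leq_mul2l.
Qed.

(** Double counting of the edges between consecutive spheres. A vertex of sphere [i] has at most one
    neighbour in ball [i], so at least [D] of its more than [D] neighbours lie in sphere [i.+1]; a
    vertex of sphere [i.+1] has at most one neighbour in sphere [i]. *)
Lemma sphere_growth S v i D : v \in S -> i < k ->
  (forall x, x \in S -> D < #|nbrs S x|) ->
  D * #|sphere S v i| <= #|sphere S v i.+1|.
Proof.
move=> vS ik degS.
have sphN x : x \in sphere S v i -> forall j, j < i -> x \notin ball S v j.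
  rewrite finset.inE => /andP[_ /forallP xN] j ji; exact: (xN (Ordinal ji)).
have deg_out x : x \in sphere S v i ->
    D <= #|[set y in sphere S v i.+1 | adj L x y]|.
  move=> xi; have xb : x \in ball S v i by move: xi; rewrite finset.inE => /andP[].
  have := degS x (fintype.subsetP (ball_sub i vS) x xb).
  rewrite -(finset.cardsID (ball S v i)) => Dlt.
  have le1 : #|nbrs S x :&: ball S v i| <= 1.
    rewrite leqNgt; apply/negP => /card_gt1P[y [z [yn zn]]].
    move: yn zn; rewrite !finset.inE => /andP[/andP[_ xy] yi] /andP[/andP[_ xz] zi].
    by rewrite (ball_nbr_unique ik (sphN x xi) yi zi xy xz) eqxx.
  have : D < 1 + #|nbrs S x :\: ball S v i|.
    by apply: leq_trans Dlt _; rewrite leq_add2r.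
  rewrite ltnS => /leq_trans; apply; apply/subset_leq_card/fintype.subsetP => y.
  rewrite !finset.inE => /andP[yN /andP[yS xy]]; rewrite xy andbT yS /=.
  apply/andP; split.
    by apply/orP; right; apply/fintype.exists_inP; exists x.
  apply/forallP => j; apply: contra yN.
  by apply: (fintype.subsetP (ball_mono _ _ _)); rewrite -ltnS.
have in_le1 y : y \in sphere S v i.+1 ->
    #|[set x in sphere S v i | adj L x y]| <= 1.
  rewrite finset.inE => /andP[_ /forallP yN].
  rewrite leqNgt; apply/negP => /card_gt1P[x [z [xn zn]]].
  move: xn zn; rewrite !finset.inE => /andP[/andP[xi _] xy] /andP[/andP[zi _] zy].
  rewrite adj_sym in xy; rewrite adj_sym in zy.
  rewrite (@ball_nbr_unique S v i y x z) ?eqxx // => j ji.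
  exact: (yN (Ordinal (leqW ji))).
have cardE (A : {set V}) (r : rel V) x : #|[set y in A | r x y]| = \sum_(y in A) r x y.
  rewrite -sum1_card big_mkcond [RHS]big_mkcond; apply: eq_bigr => y _.
  by rewrite finset.inE; case: (y \in A); case: (r x y).
rewrite mulnC -sum_nat_const.
apply: leq_trans (_ : \sum_(x in sphere S v i)
    \sum_(y in sphere S v i.+1) adj L x y <= _).
  by apply: leq_sum => x /deg_out; rewrite cardE.
rewrite exchange_big /= -sum1_card; apply: leq_sum => y /in_le1.
by rewrite (cardE _ (fun y x => adj L x y)).
Qed.

Lemma min_degree_card S D : S != finset.set0 ->
  (forall x, x \in S -> D < #|nbrs S x|) -> D ^ k <= #|V|.
Proof.
move=> /finset.set0Pn[v vS] degS.
have grow i : i <= k -> D ^ i <= #|sphere S v i|.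
  elim: i => [_|i IHi ik]; last first.
    rewrite expnS (leq_trans _ (sphere_growth vS ik degS))// leq_mul2l.
    by rewrite IHi ?orbT// ltnW.
  rewrite card_gt0; apply/finset.set0Pn; exists v.
  by rewrite finset.inE finset.set11; apply/forallP => -[].
exact: leq_trans (grow k (leqnn k)) (max_card _).
Qed.

Definition induced_edges S : {set {set V}} := [set e in L | e \subset S].

Lemma induced_edges_del S x :
  #|induced_edges S| <= #|induced_edges (S :\ x)| + #|nbrs S x|.
Proof.
apply: leq_trans (_ : _ <= #|induced_edges (S :\ x)| +
    #|[set [set x; y] | y in nbrs S x]|) _; last first.
  by rewrite leq_add2l leq_imset_card.
apply: leq_trans (leq_card_setU _ _); apply/subset_leq_card/fintype.subsetP => e.
rewrite !finset.inE => /andP[eL eS]; have [xe|xe] := boolP (x \in e); last first.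
  apply/orP; left; rewrite eL; apply/fintype.subsetP => y ye.
  rewrite finset.in_setD1 (fintype.subsetP eS)// andbT.
  by apply: contraNneq xe => <-.
apply/orP; right; have /cards2P[a [b [ab eab]]] := fintype.forall_inP simpleL _ eL.
have [y exy] : exists y, e = [set x; y].
  move: xe; rewrite eab => /finset.set2P[] ->; first by exists b.
  by exists a; rewrite finset.setUC.
apply/imsetP; exists y => //; rewrite finset.inE /adj -exy eL andbT.
by apply: (fintype.subsetP eS); rewrite exy finset.set22.
Qed.

Lemma induced_edges1 x : induced_edges [set x] = finset.set0.
Proof.
apply/eqP; rewrite -finset.subset0; apply/fintype.subsetP => e.
rewrite finset.inE => /andP[/(fintype.forall_inP simpleL)/eqP e2 /subset_leq_card].
by rewrite e2 cards1.
Qed.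

(* A minimal vertex set whose average degree is at least that of L has
   minimum degree larger than |L| / |V|. *)
Lemma moore_bound : 0 < k -> (#|L| %/ #|V|) ^ k <= #|V|.
Proof.
move=> k0; have [L0|L0] := posnP #|L|; first by rewrite L0 div0n exp0n.
have n0 : 0 < #|V|.
  have [e /(fintype.forall_inP simpleL)/eqP e2] : exists e, e \in L.
    by apply/finset.set0Pn; rewrite -card_gt0.
  by apply: leq_trans (max_card (mem e)); rewrite e2.
pose P S := (S != finset.set0) && (#|L| * #|S| <= #|V| * #|induced_edges S|).
have PT : P [set: V].
  rewrite /P -card_gt0 cardsT n0 /= mulnC leq_mul2l orbC.
  rewrite subset_leq_card //; apply/fintype.subsetP => e eL.
  by rewrite finset.inE eL finset.subsetT.
case: (arg_minnP (fun S : {set V} => #|S|) PT) => S /andP[S0 eS] minS.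
apply: (min_degree_card S0) => x xS; rewrite ltn_divLR // ltnNge.
apply/negP => degx; have cS : #|S| = #|S :\ x|.+1 by rewrite (cardsD1 x) xS.
suff : P (S :\ x) by move/minS; rewrite cS ltnn.
apply/andP; split.
  (* A single vertex induces no edge, so [S] cannot be reduced to [x] while [L] is non-empty. *)
  apply/negP => /eqP Sx; move: eS; rewrite cS Sx finset.cards0 muln1.
  rewrite -(finset.setD1K xS) Sx finset.setU0 induced_edges1 finset.cards0 muln0.
  by rewrite leqNgt L0.
rewrite -(leq_add2r #|L|) -mulnSr -cS (leq_trans eS)//.
apply: leq_trans (_ : #|V| * (#|induced_edges (S :\ x)| + #|nbrs S x|) <= _).
  by rewrite leq_mul2l induced_edges_del orbT.
by rewrite mulnDr leq_add2l mulnC.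
Qed.

End MooreBound.

(** * Unions of selected shortest paths *)

Lemma uniq_split (T : eqType) (x : T) (s1 s2 s1' s2' : seq T) :
  uniq (s1 ++ x :: s2) -> s1 ++ x :: s2 = s1' ++ x :: s2' ->
  s1 = s1' /\ s2 = s2'.
Proof.
have pos (r1 r2 : seq T) : uniq (r1 ++ x :: r2) ->
    index x (r1 ++ x :: r2) = size r1.
  rewrite cat_uniq /= => /and3P[_ + _]; rewrite negb_or => /andP[xr1 _].
  by rewrite index_cat (negPf xr1) /= eqxx addn0.
move=> us e; have us' : uniq (s1' ++ x :: s2') by rewrite -e.
have sz : size s1 = size s1' by rewrite -(pos _ _ us) -(pos _ _ us') e.
by move/eqP: e; rewrite eqseq_cat // eqseq_cons eqxx => /andP[/eqP-> /eqP->].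
Qed.

(** Cauchy-Schwarz for the sizes [a x] of the fibres of [t]: they sum to [#|U|], and their squares
    sum to the number of colliding pairs. Both sides are doubled so that
    [2 * a x * a y <= a x ^ 2 + a y ^ 2] applies term by term. *)
Lemma sqr_card_le_collisions (T T' : finType) (t : T -> T') (U : {set T}) :
  (#|U| ^ 2 <= #|T'| *
     #|[set q : T * T | [&& q.1 \in U, q.2 \in U & t q.1 == t q.2]]|)%N.
Proof.
pose a x := #|[set e in U | t e == x]|.
have -> : #|[set q : T * T | [&& q.1 \in U, q.2 \in U & t q.1 == t q.2]]| =
    (\sum_x a x ^ 2)%N.
  rewrite -sum1_card (partition_big (fun q => t q.1) xpredT) //=.
  apply: eq_bigr => x _; rewrite -mulnn -cardsX sum1_card.
  rewrite -[RHS]cardsE; apply: eq_card => -[e f]; rewrite !finset.inE /=.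
  rewrite unfold_in /= !finset.inE /=.
  case: (e \in U); case: (f \in U) => //=; rewrite ?andbF //.
  by case: (eqVneq (t e) x) => [->|]; rewrite ?andbT ?andbF // eq_sym.
have -> : #|U| = (\sum_x a x)%N.
  rewrite -sum1_card (partition_big t xpredT) //=.
  by apply: eq_bigr => x _; rewrite sum1_card -cardsE.
rewrite -(leq_pmul2l (isT : (0 < 2)%N)) expnS expn1.
have -> : (2 * (#|T'| * \sum_x a x ^ 2) =
    \sum_x \sum_y (a x ^ 2 + a y ^ 2))%N.
  under [RHS]eq_bigr do rewrite big_split /= sum_nat_const.
  by rewrite big_split /= sum_nat_const -big_distrr /= mul2n addnn.
rewrite big_distrl big_distrr /=; apply: leq_sum => x _.
rewrite big_distrr big_distrr /=; apply: leq_sum => y _.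
exact: nat_Cauchy.
Qed.

Lemma mem_cat_split (T : eqType) (x : T) (s : seq T) :
  x \in s -> exists s1 s2, s = s1 ++ x :: s2.
Proof. by case/path.splitPr => s1 s2; exists s1, s2. Qed.

Section SelectedPaths.
Variables (F : realFieldType) (V : finType) (E : {set {set V}}).
Variables (l : {set V} -> F) (pi : V -> V -> seq V).
Hypotheses (cE : connected_graph E) (tb : tie_breaking l E pi).
Implicit Types (u v x y z : V).

Let conn u v : connect (adj E) u v.
Proof. exact: forallP (forallP cE u) v. Qed.

Lemma selected_uniq u v : uniq (u :: pi u v).
Proof. by have [sp _ _] := tb; have [/and3P[]] := sp u v (conn u v). Qed.

(** Two selected paths through [x] and [z] agree between these vertices, up to direction: both
    pieces are the selected path between [x] and [z]. That piece begins with the edge from [x] to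
    [y]. *)
Lemma selected_shared_edge u v u' v' s1 x y s2 z :
  u :: pi u v = s1 ++ x :: y :: s2 -> z \in y :: s2 ->
  x \in u' :: pi u' v' -> z \in u' :: pi u' v' ->
  [set x; y] \in path_edges u' (pi u' v').
Proof.
have [_ pi_rev pi_sub] := tb; move=> uv zs.
have xz : x != z.
  apply: contraTneq zs => <-; have := selected_uniq u v.
  by rewrite uv cat_uniq => /and3P[_ _] /= /andP[].
have [r pixz] : exists r, pi x z = y :: r.
  have [p1 [p2 e]] := mem_cat_split zs.
  have := pi_sub u v x s1 (rcons p1 z) p2 (conn u v).
  rewrite last_rcons uv e /= cat_rcons => /(_ erefl) ->.
  by case: p1 e => [|y1 p1] [-> _]; [exists [::]|exists (rcons p1 z)].
move=> /mem_cat_split[a [b eab]]; rewrite eab mem_cat in_cons eq_sym (negPf xz) /=.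
case/orP => /mem_cat_split[c [d ecd]].
  have := pi_sub u' v' z c (rcons d x) b (conn u' v').
  rewrite last_rcons eab ecd -catA /= cat_rcons => /(_ erefl) pizx.
  have := pi_rev z x (conn z x); rewrite pixz pizx => /(congr1 rev).
  rewrite revK !rev_cons -!cats1 -catA /= => e.
  apply/path_edgesP; exists (c ++ rev r), y, x, b.
  rewrite finset.setUC; split=> //; rewrite eab ecd -!catA /=; congr (c ++ _).
  by rewrite -[[:: y, x & b]]/([:: y; x] ++ b) catA e /= -catA.
have := pi_sub u' v' x a (rcons c z) d (conn u' v').
rewrite last_rcons eab ecd /= cat_rcons => /(_ erefl); rewrite pixz => e.
apply/path_edgesP; exists a, x, y, (r ++ d).
by rewrite eab ecd -(cat_rcons z) -e.
Qed.

(* Charge each edge to the first path containing it and to its first endpoint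
   along that path.  Two paths diverge at most once, so distinct edges with a
   common first endpoint are determined by the pair of their paths. *)
Lemma selected_union_card (Q : seq (V * V)) (U : {set {set V}}) :
  (forall e, e \in U -> has (fun q => e \in path_edges q.1 (pi q.1 q.2)) Q) ->
  (#|U| ^ 2 <= #|V| * (size Q ^ 2 + #|U|))%N.
Proof.
move=> UQ; have [->|/finset.set0Pn[e0 e0U]] := eqVneq U finset.set0.
  by rewrite finset.cards0.
pose on (q : V * V) e := e \in path_edges q.1 (pi q.1 q.2).
pose own e := find (on^~ e) Q.
have /hasP[[x0 _] _ _] := UQ e0 e0U.
pose pt i := nth (x0, x0) Q i.
pose pth i := (pt i).1 :: pi (pt i).1 (pt i).2.
have own_lt e : e \in U -> (own e < size Q)%N by rewrite -has_find; exact: UQ.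
have own_on e : e \in U -> on (pt (own e)) e.
  by move=> eU; have := nth_find (x0, x0) (UQ e eU).
have own_first e i : (i < own e)%N -> ~~ on (pt i) e.
  by move=> ie; rewrite (before_find (x0, x0) ie).
have /choice[tail tailP] : forall e, exists x, e \in U -> exists s1 y s2,
    pth (own e) = s1 ++ x :: y :: s2 /\ e = [set x; y].
  move=> e; have [eU|eU] := boolP (e \in U); last by exists x0.
  have /path_edgesP[s1 [x [y [s2 [es ee]]]]] := own_on e eU.
  by exists x => _; exists s1, y, s2.
have tail_inj e f : e \in U -> f \in U -> own e = own f -> tail e = tail f -> e = f.
  move=> eU fU oef tef; have [s1 [y [s2 [es ee]]]] := tailP e eU.
  have [s1' [y' [s2' [fs ff]]]] := tailP f fU.
  have ue : uniq (s1 ++ tail e :: y :: s2) by rewrite -es selected_uniq.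
  have := uniq_split ue; rewrite -es oef fs -tef => /(_ _ _ erefl)[_ [yy' _]].
  by rewrite ee ff -tef yy'.
(* If the tails differed, both would lie on both paths. On the later path, one of them precedes the
   other, so [f] or [f'] leaves it towards the other and thus belongs to the earlier path as well,
   although the later path is the first one to contain it. *)
have diverge e f e' f' : [/\ e \in U, f \in U, e' \in U & f' \in U] ->
    tail e = tail f -> tail e' = tail f' -> own e = own e' -> own f = own f' ->
    (own e < own f)%N -> tail e = tail e'.
  move=> [eU fU e'U f'U] tef tef' oe of' lt_ef; apply/eqP/negPn/negP => tee'.
  have [s1 [y [s2 [fs ff]]]] := tailP f fU.
  have [s1' [y' [s2' [fs' ff']]]] := tailP f' f'U.
  have tail_in g : g \in U -> tail g \in pth (own g).
    by move=> gU; have [r1 [z [r2 [-> _]]]] := tailP g gU; rewrite mem_cat mem_head orbT.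
  have := tail_in f' f'U; rewrite -of' fs mem_cat -tef' in_cons -tef.
  rewrite [tail e' == _]eq_sym (negPf tee') /= => /orP[e's1|e's]; last first.
    have := own_first f (own e) lt_ef; rewrite ff /on -tef.
    rewrite -tef in fs; rewrite (selected_shared_edge fs e's) ?tail_in //.
    by rewrite oe tail_in.
  have es' : tail e \in y' :: s2'.
    have [p1 [p2 e1]] := mem_cat_split e's1.
    have u3 : uniq (p1 ++ tail e' :: (p2 ++ tail f :: y :: s2)).
      by rewrite -cat_cons catA -e1 -fs selected_uniq.
    have := uniq_split u3; rewrite -cat_cons catA -e1 -fs of' fs' -tef'.
    by move=> /(_ _ _ erefl)[_ <-]; rewrite tef mem_cat mem_head orbT.
  have := own_first f' (own e); rewrite -of' lt_ef => /(_ isT).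
  rewrite ff' /on -tef'; rewrite -tef' in fs'.
  by rewrite (selected_shared_edge fs' es') ?tail_in // oe tail_in.
(* Colliding pairs off the diagonal inject into pairs of path indices, whence [size Q ^ 2]; the
   diagonal accounts for the term [#|U|]. *)
pose Z := [set q : {set V} * {set V} |
  [&& q.1 \in U, q.2 \in U & tail q.1 == tail q.2]].
pose Z' := [set q in Z | q.1 != q.2].
have cZ' : (#|Z'| <= size Q ^ 2)%N.
  pose g (q : {set V} * {set V}) := (own q.1, own q.2).
  rewrite -mulnn -{1 2}(size_iota 0 (size Q)) -(size_allpairs pair) cardE.
  rewrite -(size_map g); apply: uniq_leq_size.
    rewrite map_inj_in_uniq ?enum_uniq // => -[e f] [e' f'].
    rewrite !mem_enum !finset.inE /=.
    move=> /andP[/and3P[eU fU /eqP tef] ef] /andP[/and3P[e'U f'U /eqP tef'] ef'].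
    move=> [oe of'].
    have tee' : tail e = tail e'.
      have [lt_ef|lt_fe|eq_ef] := ltngtP (own e) (own f).
      - exact: (diverge e f e' f').
      - by rewrite tef tef'; apply: (diverge f e f' e').
      - by move: ef; rewrite (tail_inj e f) ?eqxx.
    congr pair; first exact: tail_inj.
    by apply: tail_inj => //; rewrite -tef -tef'.
  move=> q /mapP[[e f]]; rewrite mem_enum !finset.inE /=.
  move=> /andP[/and3P[eU fU _] _] ->; apply/allpairsP; exists (own e, own f).
  by rewrite !mem_iota /= !own_lt.
have cZ : (#|Z| <= size Q ^ 2 + #|U|)%N.
  apply: leq_trans (_ : #|Z' :|: [set (e, e) | e in U]| <= _)%N.
    apply/subset_leq_card/fintype.subsetP => -[e f]; rewrite !finset.inE /=.
    move=> /and3P[eU fU ->]; rewrite eU fU /=.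
    by have [<-|//] := eqVneq e f; rewrite imset_f.
  by rewrite (leq_trans (leq_card_setU _ _)) // leq_add // leq_imset_card.
by rewrite (leq_trans (sqr_card_le_collisions tail U)) // leq_mul2l cZ orbT.
Qed.

End SelectedPaths.

(** * Nets and pairs with the gap property *)

(* Farthest-point insertion: r is the distance of a point to the previously
   inserted ones, so the points with r > t form a t-net, nested in t. *)
Lemma exists_nested_nets (F : realFieldType) (V : finType) (d : V -> V -> F)
    (B : F) (v0 : V) :
  (forall u v, d u v = d v u) -> (forall u, d u u = 0) ->
  (forall u v, u != v -> 0 < d u v) -> (forall u v, d u v <= B) ->
  exists r : V -> F,
    (forall u v, u != v -> Order.min (r u) (r v) <= d u v) /\
    (forall t v, 0 <= t < B -> exists2 a, t < r a & d v a <= t).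
Proof.
move=> d_sym d0 d_gt0 dB.
pose cov (S : {set V}) t := forall v, exists2 a, a \in S & d v a <= t.
(* Invariant for the inserted set [S]: each radius is a covering radius of [S], so the next radius
   cannot be larger, and at any scale below [B] at which [S] covers, its points of radius above that
   scale already cover. *)
have build n (S : {set V}) (r : V -> F) : (#|~: S| <= n)%N -> v0 \in S ->
    (forall u v, u \in S -> v \in S -> u != v -> Order.min (r u) (r v) <= d u v) ->
    (forall a, a \in S -> cov S (r a)) ->
    (forall t v, t < B -> cov S t ->
       exists2 a, a \in S & t < r a /\ d v a <= t) ->
    exists r : V -> F,
    (forall u v, u != v -> Order.min (r u) (r v) <= d u v) /\
    (forall t v, 0 <= t < B -> exists2 a, t < r a & d v a <= t).
  elim: n S r => [|n IHn] S r cS v0S sepS covS netS.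
    have ST v : v \in S.
      move: cS; rewrite leqn0 finset.cards_eq0 => /eqP/finset.setP/(_ v).
      by rewrite !finset.inE => /negbFE.
    exists r; split=> [u v uv|t v /andP[t0 tB]]; first exact: sepS.
    have [v'|a _ [ra da]] := netS t v tB; last by exists a.
    by exists v'; rewrite ?d0.
  have [[v vS]|allS] := pselect (exists v, v \notin S); last first.
    apply: (IHn S r) => //; rewrite (_ : ~: S = finset.set0) ?finset.cards0 //.
    apply/finset.setP => v; rewrite !finset.inE; apply/negbTE/negP => vS.
    by apply: allS; exists v.
  pose nr u := [arg min_(a < v0 in S) d u a]%O.
  have nrS u : nr u \in S by rewrite /nr; case: arg_minP.
  have nr_min u a : a \in S -> d u (nr u) <= d u a.
    by move=> aS; rewrite /nr; case: arg_minP => // b _; apply.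
  pose z := [arg max_(u > v0) d u (nr u)]%O.
  have z_max u : d u (nr u) <= d z (nr z).
    by rewrite /z; case: arg_maxP => // b _; apply.
  have zS : z \notin S.
    apply/negP => zS; have := le_trans (z_max v) (nr_min z z zS).
    by rewrite d0 leNgt d_gt0 //; apply: contraNneq vS => ->.
  pose r' u := if u == z then d z (nr z) else r u.
  have r'S u : u \in S -> r' u = r u.
    by move=> uS; rewrite /r' ifN //; apply: contraNneq zS => <-.
  have r'z : r' z = d z (nr z) by rewrite /r' eqxx.
  have covD : cov S (d z (nr z)) by move=> u; exists (nr u).
  have le_r a : a \in S -> d z (nr z) <= r a.
    by move=> aS; have [b bS] := covS a aS z; apply: le_trans (nr_min z b bS).
  have covSz t : cov S t -> cov (z |: S) t.
    by move=> covt u; have [b bS db] := covt u; exists b => //; rewrite finset.setU1r.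
  apply: (IHn (z |: S) r').
  - rewrite -ltnS; apply: leq_trans cS; apply/proper_card/fintype.properP.
    split; first by rewrite finset.setCS finset.subsetUr.
    by exists z; rewrite finset.in_setC ?zS // finset.setU11.
  - by rewrite finset.setU1r.
  - move=> u x; rewrite !finset.in_setU1 ge_min.
    case/predU1P => [->|uS]; case/predU1P => [->|xS] ux.
    + by rewrite eqxx in ux.
    + by rewrite r'z nr_min.
    + by rewrite r'z d_sym nr_min ?orbT.
    + by rewrite !r'S // -ge_min sepS.
  - move=> a; rewrite finset.in_setU1 => /predU1P[->|aS]; apply: covSz.
      by rewrite r'z.
    by rewrite r'S //; apply: covS.
  - move=> t x tB covt.
    have [/netS net|ncov] := pselect (cov S t).
      have [a aS [ra da]] := net x tB; exists a; first by rewrite finset.setU1r.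
      by rewrite r'S.
    (* As [S] does not cover at scale [t], the new radius exceeds [t], and so do all the earlier
       ones: every point of [z |: S] counts. *)
    have tD : t < d z (nr z).
      rewrite ltNge; apply/negP => Dt; apply: ncov => u; exists (nr u) => //.
      exact: le_trans (z_max u) Dt.
    have [a aS da] := covt x; exists a => //; split=> //; move: aS.
    rewrite finset.in_setU1 => /predU1P[->|aS]; first by rewrite r'z.
    by rewrite r'S // (lt_le_trans tD) // le_r.
(* The initial point has no predecessor and receives the radius [B], which limits the scales to
   [t < B]. *)
apply: (build _ [set v0] (fun=> B) (leqnn _)).
- exact: finset.set11.
- by move=> u v /finset.set1P-> /finset.set1P->; rewrite eqxx.
- by move=> a _ v; exists v0; rewrite ?finset.set11.
- by move=> t v tB covt; have [a aS da] := covt v; exists a.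
Qed.

Section SupDistance.
Variables (R : realType) (n : nat).
Implicit Types x y z : 'rV[R]_n.

(** The packing argument uses this metric because its balls are the cells of a grid; it agrees with
    the Euclidean distance up to the factor [n.+1], which is positive even in dimension 0. *)
Definition sup_dist x y : R :=
  \big[Order.max/0]_(i < n) `|x ord0 i - y ord0 i|.

Lemma sup_dist_leP x y (t : R) : 0 <= t ->
  reflect (forall i, `|x ord0 i - y ord0 i| <= t) (sup_dist x y <= t).
Proof.
move=> t0; apply: (iffP (bigmax_leP _ _ _ _)) => [[_ le_t] i|le_t]; first exact: le_t.
by split.
Qed.

Lemma sup_dist_ge0 x y : 0 <= sup_dist x y.
Proof. exact: bigmax_ge_id. Qed.

Lemma sup_dist_coord x y i : `|x ord0 i - y ord0 i| <= sup_dist x y.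
Proof. exact/sup_dist_leP/lexx/sup_dist_ge0. Qed.

Lemma sup_distC x y : sup_dist x y = sup_dist y x.
Proof. by apply: eq_bigr => i _; rewrite distrC. Qed.

Lemma sup_distxx x : sup_dist x x = 0.
Proof.
apply/le_anti; rewrite sup_dist_ge0 andbT.
by apply/sup_dist_leP => // i; rewrite subrr normr0.
Qed.

Lemma sup_dist_gt0 x y : x != y -> 0 < sup_dist x y.
Proof.
move=> xy; rewrite lt_neqAle sup_dist_ge0 andbT; apply: contra xy => /eqP e.
apply/eqP/rowP => i; apply/eqP; rewrite -subr_eq0 -normr_le0 e.
exact: sup_dist_coord.
Qed.

Lemma sup_dist_triangle x y z : sup_dist x z <= sup_dist x y + sup_dist y z.
Proof.
apply/sup_dist_leP => [|i]; first by rewrite addr_ge0 ?sup_dist_ge0.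
by rewrite (le_trans (ler_distD (y ord0 i) _ _)) // lerD ?sup_dist_coord.
Qed.

Lemma sup_dist_le_euclid x y : sup_dist x y <= euclid_dist x y.
Proof.
apply/sup_dist_leP => [|i]; first exact: sqrtr_ge0.
rewrite -sqrtr_sqr /euclid_dist; apply: ler_wsqrtr.
by rewrite (bigD1 i) //= lerDl sumr_ge0 // => j _; rewrite sqr_ge0.
Qed.

Lemma euclid_le_sup_dist x y : euclid_dist x y <= n.+1%:R * sup_dist x y.
Proof.
rewrite /euclid_dist -[leRHS]ger0_norm ?mulr_ge0 ?sup_dist_ge0 ?ler0n //.
rewrite -sqrtr_sqr; apply: ler_wsqrtr.
apply: le_trans (_ : \sum_(i < n) sup_dist x y ^+ 2 <= _).
  apply: ler_sum => i _; rewrite -real_normK ?num_real //.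
  by rewrite lerXn2r ?nnegrE ?sup_dist_ge0 ?normr_ge0 ?sup_dist_coord.
rewrite sumr_const card_ord exprMn -[leLHS]mulr_natl ler_wpM2r ?sqr_ge0 //.
by rewrite -natrX ler_nat expnS expn1 (leq_trans (leqnSn n)) // leq_pmulr.
Qed.

End SupDistance.

(* Each pair is charged to a net point [a] whose insertion radius is comparable
   to the length of the pair and which is close to both of its ends; the pairs
   charged to [a] are told apart by the grid cells, of side a fixed multiple of
   that radius, of their ends. *)
Lemma gap_pairs_card (R : realType) (n : nat) (c : R) : 0 < c ->
  exists N : nat, forall (V : finType) (pt : V -> 'rV[R]_n) (L : {set V * V}),
    injective pt -> (forall q, q \in L -> q.1 != q.2) ->
    (forall q q', q \in L -> q' \in L ->
       sup_dist (pt q.1) (pt q'.1) <= c * sup_dist (pt q.1) (pt q.2) ->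
       sup_dist (pt q.2) (pt q'.2) <= c * sup_dist (pt q.1) (pt q.2) ->
       q = q') ->
    (#|L| <= #|V| * N)%N.
Proof.
(* The ends of a pair charged to [a] are within [5 * r a] of it. In units of the cell side
   [c * r a / 2] this is [10 / c] on either side, so the shifted coordinates lie in an interval of
   length [20 / c]. *)
move=> c0; pose m := Num.truncn (20 / c).
exists (m.+1 ^ n * m.+1 ^ n)%N => V pt L pt_inj L_neq L_gap.
have [->|/finset.set0Pn[q0 q0L]] := eqVneq L finset.set0; first by rewrite finset.cards0.
pose d u v := sup_dist (pt u) (pt v).
have d_gt0 u v : u != v -> 0 < d u v.
  by move=> uv; apply: sup_dist_gt0; rewrite (inj_eq pt_inj).
have d_tri u v x : d u x <= d u v + d v x by apply: sup_dist_triangle.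
have d_sym u v : d u v = d v u by apply: sup_distC.
pose B := \big[Order.max/0]_(q : V * V) d q.1 q.2.
have dB u v : d u v <= B by apply: (le_bigmax _ (fun q : V * V => d q.1 q.2) (u, v)).
have [r [r_sep r_cov]] :=
  exists_nested_nets q0.1 d_sym (fun u => sup_distxx (pt u)) d_gt0 dB.
have charge q : exists a, q \in L -> [/\ d q.1 q.2 <= 4 * r a,
    2 * r a <= 3 * d q.1 q.2, d q.1 a <= 5 * r a & d q.2 a <= 5 * r a].
  have [qL|_] := boolP (q \in L); last by exists q.1.
  have l0 := d_gt0 _ _ (L_neq q qL); set len := d q.1 q.2 in l0 *.
  (* At scale [len / 4] the ends have net points [a] and [b], which differ, for otherwise
     [len <= len / 2]. Both radii exceed [len / 4], and by separation one of them is at most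
     [d a b <= 3 / 2 * len]; that point takes the charge. *)
  have t_bound : 0 <= len / 4 < B.
    by have := dB q.1 q.2; rewrite -/len => lB; apply/andP; split; lra.
  have [a ra da] := r_cov _ q.1 t_bound; have [b rb db] := r_cov _ q.2 t_bound.
  have := d_tri q.1 a q.2; have := d_tri q.2 b q.1.
  have := d_tri a q.1 b; have := d_tri q.1 q.2 b.
  have := d_tri q.1 b q.2; have := d_tri q.2 q.1 a.
  rewrite (d_sym a q.2) (d_sym b q.1) (d_sym b q.2) (d_sym a q.1) (d_sym q.2 q.1) -/len.
  move=> t1 t2 t3 t4 t5 t6.
  have ab : a != b by apply/eqP => eab; move: db t6; rewrite -eab => db t6; lra.
  have := r_sep a b ab; rewrite ge_min => /orP[rab|rab].
    by exists a => _; split; lra.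
  by exists b => _; split; lra.
have [a aP] := choice charge.
pose coord (q : V * V) u i :=
  (pt u ord0 i - pt (a q) ord0 i) / (c * r (a q) / 2) + 10 / c.
pose cell q u : {ffun 'I_n -> 'I_m.+1} := [ffun i => inord (Num.truncn (coord q u i))].
have r_gt0 q : q \in L -> 0 < r (a q).
  by move=> qL; have [? _ _ _] := aP q qL; have := d_gt0 _ _ (L_neq q qL); lra.
have coord_bound q u i : q \in L -> d u (a q) <= 5 * r (a q) ->
    0 <= coord q u i <= 20 / c.
  move=> qL du; have r0 := r_gt0 q qL.
  have := le_trans (sup_dist_coord (pt u) (pt (a q)) i) du.
  have s0 : 0 < c * r (a q) / 2 by rewrite divr_gt0 ?mulr_gt0.
  have -> : 5 * r (a q) = 10 / c * (c * r (a q) / 2) by field; rewrite gt_eqF.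
  rewrite -ler_pdivrMr // -{1}(ger0_norm (ltW s0)) -normf_div ler_norml => /andP[lo hi].
  rewrite /coord; have -> : 20 / c = 10 / c + 10 / c by field; rewrite gt_eqF.
  by rewrite lerD2r hi andbT -lerBlDr sub0r.
have same_cell q q' u u' : q \in L -> a q = a q' ->
    d u (a q) <= 5 * r (a q) -> d u' (a q) <= 5 * r (a q) ->
    cell q u = cell q' u' -> d u u' <= c * d q.1 q.2.
  move=> qL aqq' du du' cuu'; have r0 := r_gt0 q qL.
  have s0 : 0 < c * r (a q) / 2 by rewrite divr_gt0 ?mulr_gt0.
  have [_ rl _ _] := aP q qL.
  (* The charging gives [r (a q) <= 3 / 2 * d q.1 q.2], so a cell is narrow enough for the gap
     hypothesis. *)
  have sl : c * r (a q) / 2 <= c * d q.1 q.2.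
    by rewrite -mulrA ler_wpM2l ?(ltW c0)//; lra.
  apply/sup_dist_leP => [|i]; first exact: le_trans (ltW s0) sl.
  have /andP[x0 xM] := coord_bound q u i qL du.
  have /andP[y0 yM] := coord_bound q u' i qL du'.
  have trunc_lt x : x <= 20 / c -> (Num.truncn x < m.+1)%N.
    by move=> xc; rewrite ltnS; apply: le_truncn.
  have := congr1 (fun f : {ffun 'I_n -> 'I_m.+1} => val (f i)) cuu'.
  rewrite !ffunE /= (_ : coord q' u' i = coord q u' i); last by rewrite /coord aqq'.
  rewrite !inordK ?trunc_lt // => tE.
  have /andP[x1 x2] := truncn_itv x0; have /andP[y1 y2] := truncn_itv y0.
  rewrite -tE in y1 y2.
  have : `|coord q u i - coord q u' i| <= 1.
    by move: x2 y2; rewrite -natr1 ler_norml => x2 y2; apply/andP; split; lra.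
  have -> : coord q u i - coord q u' i =
      (pt u ord0 i - pt u' ord0 i) / (c * r (a q) / 2).
    by rewrite /coord; field; rewrite !gt_eqF.
  rewrite normf_div (ger0_norm (ltW s0)) ler_pdivrMr // mul1r => /le_trans; exact.
pose f q := (a q, (cell q q.1, cell q q.2)).
rewrite -(card_in_imset (f := f)); last first.
  move=> q q' qL q'L [aqq' c1 c2]; apply: L_gap => //.
    have [_ _ d1 _] := aP q qL; have [_ _ d1' _] := aP q' q'L.
    by apply: (same_cell q q'); rewrite // aqq'.
  have [_ _ _ d2] := aP q qL; have [_ _ _ d2'] := aP q' q'L.
  by apply: (same_cell q q'); rewrite // aqq'.
by rewrite (leq_trans (max_card _)) // !card_prod !card_ffun !card_ord.
Qed.

(** * The greedy run *)

Lemma index_le_mem (T : eqType) (x y : T) (s1 s2 : seq T) :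
  uniq (s1 ++ x :: s2) ->
  (index y (s1 ++ x :: s2) <= index x (s1 ++ x :: s2))%N -> y != x -> y \in s1.
Proof.
rewrite cat_uniq /= => /and3P[_ + _]; rewrite negb_or => /andP[xs1 _] le_yx yx.
apply: contraLR le_yx => ys1.
by rewrite !index_cat (negPf ys1) (negPf xs1) /= eqxx eq_sym (negPf yx) -ltnNge ltn_add2l.
Qed.

(** The cycle is rotated so that an edge of largest rank closes it. The rank will be the position in
    the processing order, so this isolates the edge processed last. *)
Lemma cycle_max_edge (V : finType) (L : {set {set V}}) (rank : {set V} -> nat)
    (c : seq V) : ucycle (adj L) c -> (2 < size c)%N ->
  exists x p, [/\ size p = (size c).-1, path (adj L) x p, [set x; last x p] \in L,
    [set x; last x p] \notin path_edges x p
    & forall f, f \in path_edges x p -> (rank f <= rank [set x; last x p])%N].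
Proof.
move=> /andP[cc uc] szc; have [x0 x0c] : exists x0, x0 \in c.
  by case: c szc {cc uc} => // x0 c _; exists x0; rewrite mem_head.
case: (@arg_maxnP _ x0 (mem c) (fun y => rank [set prev c y; y]) x0c) => x xc x_max.
have [i p cE] := rot_to xc; have ux : uniq (x :: p) by rewrite -cE rot_uniq.
have szp : size p = (size c).-1 by rewrite -(size_rot i c) cE.
have /= : cycle (adj L) (x :: p) by rewrite -cE rot_cycle.
rewrite rcons_path => /andP[xp px].
have prevE s1 a b s2 : x :: p = s1 ++ a :: b :: s2 -> prev c b = a.
  move=> e; rewrite -(prev_rot i uc) cE prev_nth.
  have -> : b \in x :: p by rewrite e mem_cat !in_cons eqxx !orbT.
  have ue := ux; rewrite e in ue.
  have bp : index b p = size s1.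
    case: s1 e ue => [|y s1] [_ ->]; first by rewrite /= eqxx.
    rewrite /= -cat_rcons cat_uniq => /and4P[_ _ + _] /=.
    rewrite negb_or => /andP[bs1 _].
    by rewrite index_cat (negPf bs1) /= eqxx addn0 size_rcons.
  by rewrite bp e nth_cat ltnn subnn.
have prevx : prev c x = last x p.
  rewrite -(prev_rot i uc) cE prev_nth mem_head.
  have /memNindex-> : x \notin p by case/andP: ux.
  by rewrite -last_nth.
exists x, p; split=> //.
- by rewrite finset.setUC; exact: px.
- move: szp ux; case: p {cE xp px prevE prevx} => [|y [|z p]] szp ux.
  + by case: (size c) szp szc => [|[|[]]].
  + by case: (size c) szp szc => [|[|[]]].
  + exact: (closing_edge_notin ux).
move=> f /path_edgesP[s1 [a [b [s2 [e ->]]]]].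
rewrite -prevx finset.setUC -(prevE _ _ _ _ e) finset.setUC.
have bc : b \in c by rewrite -(mem_rot i) cE e mem_cat !in_cons eqxx !orbT.
by have := x_max b bc; rewrite [in X in (_ <= X)%N -> _]finset.setUC.
Qed.

Section GreedyRun.
Variables (F : realFieldType) (V : finType) (E E' : {set {set V}}).
Variables (l : {set V} -> F) (alpha : F) (pi : V -> V -> seq V).
Variable s : seq (V * V).
Hypotheses (simpleE : simple_graph E) (cE : connected_graph E).
Hypothesis l_gt0 : forall e, e \in E -> 0 < l e.
Let delta := mult_demand E l alpha.
Hypothesis fE' : feasible E l delta E'.
Hypothesis tb : tie_breaking l E' pi.
Hypothesis order_s : processing_order E' (metric_edges E l) l s.
Implicit Types (q : V * V) (r : seq (V * V)) (H : {set {set V}}).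

Let edge q := [set q.1; q.2].
Let run r := foldl (greedy_step l delta pi) finset.set0 r.

Let sE'E : E' \subset E. Proof. by case/andP: fE'. Qed.

Let cE' : connected_graph E'.
Proof. exact: (feasible_connected (alpha := alpha) l_gt0 cE fE'). Qed.

Let path_pi q : path (adj E') q.1 (pi q.1 q.2).
Proof.
have [sp _ _] := tb.
by have [/and3P[]] := sp q.1 q.2 (forallP (forallP cE' q.1) q.2).
Qed.

Lemma listed_metric q : q \in s -> edge q \in metric_edges E l.
Proof.
have [/perm_mem sK _] := order_s => qs.
by rewrite -mem_enum -sK; apply/mapP; exists q.
Qed.

Lemma metric_listed e : e \in metric_edges E l -> exists2 q, q \in s & e = edge q.
Proof. by have [/perm_mem sK _] := order_s; rewrite -mem_enum -sK => /mapP. Qed.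

Lemma uniq_edges : uniq [seq edge q | q <- s].
Proof. by have [/perm_uniq -> _] := order_s; apply: enum_uniq. Qed.

Lemma uniq_pairs : uniq s. Proof. exact: map_uniq uniq_edges. Qed.

Lemma listed_delta q : q \in s -> delta q.1 q.2 = (alpha * l (edge q))%:E.
Proof.
move=> qs; have em := listed_metric qs.
rewrite /delta /mult_demand (metric_edge_dist simpleE l_gt0 em) ?EFinM //.
exact: metric_edge_in em.
Qed.

Lemma greedy_step_sub H q : H \subset greedy_step l delta pi H q.
Proof. by rewrite /greedy_step; case: ifP => // _; apply: finset.subsetUl. Qed.

Lemma greedy_foldl_sub H r : H \subset foldl (greedy_step l delta pi) H r.
Proof.
elim: r H => //= q r IHr H.
exact: fintype.subset_trans (greedy_step_sub _ _) (IHr _).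
Qed.

Lemma run_cat_sub r r' : run r \subset run (r ++ r').
Proof. by rewrite /run foldl_cat greedy_foldl_sub. Qed.

Lemma run_sub r : run r \subset E'.
Proof.
elim/last_ind: r => [|r q IHr]; first exact: finset.sub0set.
rewrite /run foldl_rcons -/(run r) /greedy_step; case: ifP => // _.
rewrite finset.subUset IHr; apply/fintype.subsetP => e; rewrite finset.inE.
by move: (path_pi q); rewrite path_adjE => /allP; apply.
Qed.

Let run_l_gt0 r e : e \in run r -> 0 < l e.
Proof. by move=> /(fintype.subsetP (run_sub r))/(fintype.subsetP sE'E)/l_gt0. Qed.

Lemma mem_run r e : e \in run r -> exists r1 q r2, [/\ r = r1 ++ q :: r2,
  (delta q.1 q.2 < dist l (run r1) q.1 q.2)%E & e \in path_edges q.1 (pi q.1 q.2)].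
Proof.
elim/last_ind: r => [|r q IHr]; first by rewrite finset.in_set0.
have old : e \in run r -> exists r1 q' r2, [/\ rcons r q = r1 ++ q' :: r2,
    (delta q'.1 q'.2 < dist l (run r1) q'.1 q'.2)%E
    & e \in path_edges q'.1 (pi q'.1 q'.2)].
  move=> /IHr[r1 [q' [r2 [-> dq eq']]]]; exists r1, q', (rcons r2 q).
  by rewrite rcons_cat.
rewrite /run foldl_rcons -/(run r) /greedy_step; case: ifP => // dq.
rewrite finset.in_setU => /orP[/old//|]; rewrite finset.inE => eq.
by exists r, q, [::]; rewrite cats1.
Qed.

(** When a demand is violated, the path added is shortest in [E'] and meets the demand because [E']
    is feasible; later additions cannot increase distances. *)
Lemma run_stretch r q : q \in r ->
  (dist l (run r) q.1 q.2 <= delta q.1 q.2)%E.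
Proof.
elim/last_ind: r => // r q' IHr; rewrite mem_rcons in_cons => /predU1P[->|qr].
  rewrite /run foldl_rcons -/(run r) /greedy_step; case: ltP => // _.
  have [sp _ _] := tb.
  have [/and3P[up lp uq] len] := sp q'.1 q'.2 (forallP (forallP cE' q'.1) q'.2).
  apply: le_trans (_ : dist l E' q'.1 q'.2 <= _)%E; last first.
    by case/andP: fE' => _ /forallP/(_ q'.1)/forallP/(_ q'.2).
  rewrite -len; apply: dist_le_simple; rewrite /simple_path lp uq !andbT.
  rewrite path_adjE; apply/allP => f fp /=.
  by rewrite finset.in_setU [in X in _ || X]finset.inE fp orbT.
rewrite -cats1; apply: le_trans (IHr qr); apply: dist_mono; exact: run_cat_sub.
Qed.

Lemma run_feasible : 0 <= alpha -> feasible E l delta (run s).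
Proof.
move=> alpha0; apply: spanner_feasible => //.
  exact: fintype.subset_trans (run_sub s) sE'E.
move=> x y /[dup] xym /metric_listed[q qs xyq].
rewrite xyq; apply: dist_set2_le (@run_l_gt0 s) xyq _.
by rewrite -listed_delta // run_stretch.
Qed.

Lemma earlier_dist r1 q r2 q' : s = r1 ++ q :: r2 -> q' \in r1 ->
  (dist l E' q'.1 q'.2 <= dist l E' q.1 q.2)%E.
Proof.
have [_ +] := order_s => + sE; rewrite sE sorted_pairwise; last first.
  by move=> a b c; apply: le_trans.
rewrite pairwise_cat => /andP[/allrelP/(_ q' q) + _] q'r1; apply=> //.
exact: mem_head.
Qed.

Lemma dist_lt_earlier r1 q r2 q' : s = r1 ++ q :: r2 -> q' \in s ->
  (dist l E' q'.1 q'.2 < dist l E' q.1 q.2)%E -> q' \in r1.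
Proof.
move=> sE; rewrite sE mem_cat in_cons => /or3P[//|/eqP->|q'r2].
  by rewrite ltxx.
have [r3 [r4 r2E]] := mem_cat_split q'r2.
rewrite ltNge (@earlier_dist (r1 ++ q :: r3) q' r4) //.
  by rewrite sE r2E -catA.
by rewrite mem_cat mem_head orbT.
Qed.

(** Ordered pairs rather than edges: the geometric argument matches first ends with first ends and
    second ends with second ends, in the orientation fixed by [s]. *)
Definition added_light : {set V * V} :=
  [set q | `[< edge q \in E' /\ exists r1 r2, s = r1 ++ q :: r2 /\
     (delta q.1 q.2 < dist l (run r1) q.1 q.2)%E >]].

Lemma added_lightP q : q \in added_light -> edge q \in E' /\
  exists r1 r2, s = r1 ++ q :: r2 /\ (delta q.1 q.2 < dist l (run r1) q.1 q.2)%E.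
Proof. by rewrite finset.inE => /asboolP. Qed.

Lemma added_light_listed q : q \in added_light -> q \in s.
Proof.
by move=> /added_lightP[_ [r1 [r2 [-> _]]]]; rewrite mem_cat mem_head orbT.
Qed.

Lemma light_dist q : q \in s -> edge q \in E' ->
  dist l E' q.1 q.2 = (l (edge q))%:E.
Proof. by move=> qs; apply: metric_edge_dist (listed_metric qs) sE'E. Qed.

Let pi_length q : path_length l q.1 (pi q.1 q.2) = fine (dist l E' q.1 q.2).
Proof.
have [sp _ _] := tb.
by have [_ <-] := sp q.1 q.2 (forallP (forallP cE' q.1) q.2).
Qed.

Let simple_pi q : simple_path E' q.1 q.2 (pi q.1 q.2).
Proof. by have [sp _ _] := tb; have [] := sp q.1 q.2 (forallP (forallP cE' q.1) q.2). Qed.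

Lemma light_path_edge q e : q \in s -> edge q \in E' ->
  e \in path_edges q.1 (pi q.1 q.2) -> e = edge q.
Proof.
move=> qs qE'; apply: metric_edge_path (listed_metric qs) sE'E (simple_pi q) _ _ => //.
by rewrite pi_length light_dist.
Qed.

Lemma light_edge_on_path q : q \in s -> edge q \in E' ->
  edge q \in path_edges q.1 (pi q.1 q.2).
Proof.
move=> qs qE'; apply: metric_edge_on_path (listed_metric qs) sE'E (simple_pi q) _.
by rewrite pi_length light_dist.
Qed.

Lemma added_light_in_run r1 r2 q : s = r1 ++ r2 -> q \in added_light ->
  q \in r1 -> edge q \in run r1.
Proof.
move=> sE qA /mem_cat_split[r3 [r4 r1E]].
have qs := added_light_listed qA; have [qE' [p1 [p2 [sp dq]]]] := added_lightP qA.
have us : uniq (p1 ++ q :: p2) by rewrite -sp uniq_pairs.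
have [p1E _] : p1 = r3 /\ p2 = r4 ++ r2.
  by apply: (uniq_split us); rewrite -sp sE r1E -catA.
rewrite r1E -cat_rcons; apply: (fintype.subsetP (run_cat_sub _ _)).
rewrite /run foldl_rcons -/(run r3) /greedy_step -p1E dq.
by rewrite finset.in_setU [in X in _ || X]finset.inE light_edge_on_path ?orbT.
Qed.

(** Each edge of the output entered with some pair. For a light pair the selected path is the edge
    of the pair itself; the edges brought in by the other pairs form [U]. *)
Lemma run_card : exists2 U : {set {set V}},
  (forall e, e \in U -> has (fun q => e \in path_edges q.1 (pi q.1 q.2))
     [seq q <- s | edge q \notin E'])
  & (#|run s| <= #|[set edge q | q in added_light]| + #|U|)%N.
Proof.
exists [set e in run s | has (fun q => e \in path_edges q.1 (pi q.1 q.2))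
   [seq q <- s | edge q \notin E']]; first by move=> e; rewrite finset.inE => /andP[].
apply: leq_trans (leq_card_setU _ _); apply/subset_leq_card/fintype.subsetP => e er.
rewrite finset.in_setU [in X in _ || X]finset.inE er /=.
have [r1 [q [r2 [sE dq eq]]]] := mem_run er.
have qs : q \in s by rewrite sE mem_cat mem_head orbT.
have [qE'|qE'] := boolP (edge q \in E').
  rewrite (light_path_edge qs qE' eq) imset_f // finset.inE.
  by apply/asboolP; split=> //; exists r1, r2.
by apply/orP; right; apply/hasP; exists q; rewrite ?mem_filter ?qE'.
Qed.

Lemma heavy_pairs_size :
  (size [seq q <- s | edge q \notin E'] <= #|E :\: E'|)%N.
Proof.
rewrite cardE -(size_map edge); apply: uniq_leq_size.
  exact: subseq_uniq (map_subseq _ (filter_subseq _ _)) uniq_edges.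
move=> e /mapP[q]; rewrite mem_filter => /andP[qE' /listed_metric qm] ->.
by rewrite mem_enum finset.in_setD qE' (metric_edge_in qm).
Qed.

(** The other edges of a short cycle are at most [2 * k - 1] in number and already present when the
    last one is examined. Each is no longer than it, as light pairs are ordered by edge length, so
    they form a detour within the stretch [alpha]. *)
Lemma added_light_no_short_cycle k (c : seq V) : alpha = (2 * k)%:R - 1 ->
  ucycle (adj [set edge q | q in added_light]) c ->
  (size c <= 2)%N || (2 * k < size c)%N.
Proof.
move=> alphaE cc; rewrite leqNgt -implybE; apply/implyP => szc.
rewrite ltnNge; apply/negP => szk.
pose rank e := index e [seq edge q | q <- s].
have [x [p [szp xp /imsetP[q qA xq] xNp rank_max]]] := cycle_max_edge rank cc szc.
have [qE' [r1 [r2 [sE dq]]]] := added_lightP qA.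
have qs := added_light_listed qA.
have l0 : 0 < l (edge q) by apply/l_gt0/(fintype.subsetP sE'E).
have earlier f : f \in path_edges x p -> f \in run r1 /\ l f <= l (edge q).
  move=> fp; have : f \in [set edge q | q in added_light].
    by move: xp; rewrite path_adjE => /allP; apply.
  case/imsetP => q' q'A fq'; have q's := added_light_listed q'A.
  have [q'E' _] := added_lightP q'A.
  have q'r1 : q' \in r1.
    have fq : f != edge q by apply: contraNneq xNp; rewrite xq => <-.
    have := uniq_edges; rewrite sE map_cat /= => ue.
    have := rank_max f fp; rewrite /rank xq sE map_cat /= => /(index_le_mem ue)/(_ fq).
    case/mapP => q'' q''r1; rewrite fq' => eq''.
    suff -> : q' = q'' by [].
    have := uniq_edges; move/(uniqP (edge q)) => inj_s.
    have q''s : q'' \in s by rewrite sE mem_cat q''r1.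
    have := inj_s (index q' s) (index q'' s).
    rewrite !inE size_map !index_mem => /(_ q's q''s).
    rewrite !(nth_map q) ?index_mem // !nth_index // => /(_ eq'') eqi.
    by rewrite -(nth_index q q's) eqi nth_index.
  split; first by rewrite fq'; apply: added_light_in_run sE q'A q'r1.
  rewrite fq' -lee_fin -!light_dist //; exact: earlier_dist sE q'r1.
have xpr : path (adj (run r1)) x p.
  by rewrite path_adjE; apply/allP => f /earlier[].
have len : path_length l x p <= alpha * l (edge q).
  apply: le_trans (_ : (size p)%:R * l (edge q) <= _).
    rewrite /path_length -(size_pairmap (fun x y : V => [set x; y]) x p).
    rewrite -/(path_edges x p); elim: (path_edges x p) earlier => [|f fs IHf] fl.
      by rewrite big_nil mul0r.
    rewrite big_cons /= -natr1 mulrDl mul1r addrC lerD //.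
      by apply: IHf => g gfs; apply: fl; rewrite in_cons gfs orbT.
    by have [] := fl f (mem_head _ _).
  rewrite ler_wpM2r ?(ltW l0) // szp alphaE lerBrDr natr1 ler_nat.
  by rewrite prednK // (leq_trans _ szc).
have dx : (dist l (run r1) x (last x p) <= (alpha * l (edge q))%:E)%E.
  by apply: le_trans (dist_le_walk (@run_l_gt0 r1) xpr) _; rewrite lee_fin.
have := dist_set2_le (@run_l_gt0 r1) (esym xq) dx.
by rewrite leNgt -listed_delta // dq.
Qed.

(** The walk from [q.1] to [q'.1], along the edge of [q'], and on to [q.2] would already satisfy the
    demand of [q]: the edge of [q'] is no longer than that of [q], and each side trip costs at most
    [alpha * eps] times that length. *)
Lemma added_light_gap (eps : F) r1 r2 q q' : 0 <= alpha ->
  alpha * eps < 1 -> 1 + 2 * alpha * eps <= alpha ->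
  s = r1 ++ q :: r2 -> q \in added_light -> q' \in added_light -> q' \in r1 ->
  (dist l E q.1 q'.1 <= (eps * l (edge q))%:E)%E ->
  (dist l E q.2 q'.2 <= (eps * l (edge q))%:E)%E -> False.
Proof.
move=> alpha0 eps1 eps2 sE qA q'A q'r1 d1 d2.
have qs := added_light_listed qA; have q's := added_light_listed q'A.
have [qE' [p1 [p2 [sp dq]]]] := added_lightP qA; have [q'E' _] := added_lightP q'A.
have l0 : 0 < l (edge q) by apply/l_gt0/(fintype.subsetP sE'E).
have [p1E _] : p1 = r1 /\ p2 = r2.
  by apply: (@uniq_split _ q); rewrite -sp // uniq_pairs.
rewrite p1E listed_delta // in dq.
have near u v : (dist l E u v <= (eps * l (edge q))%:E)%E ->
    (dist l (run r1) u v <= (alpha * (eps * l (edge q)))%:E)%E.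
  move=> /dist_leP[p /and3P[up /eqP <- _] pl].
  apply: le_trans (stretch_of_metric_edges simpleE l_gt0 _ alpha0 _ up pl) _.
  - exact: fintype.subset_trans (run_sub r1) sE'E.
  - move=> x y /[dup] xym /metric_listed[q'' q''s xyq''] xyl.
    (* The pair may be heavy, so its place in the order depends on its distance in [E']. By
       feasibility this is at most [alpha * eps * l (edge q)], below [l (edge q)]. *)
    have q''r1 : q'' \in r1.
      apply: (dist_lt_earlier sE q''s); rewrite (light_dist qs qE').
      apply: (@le_lt_trans _ _ (delta q''.1 q''.2)).
        by case/andP: fE' => _ /forallP/(_ q''.1)/forallP/(_ q''.2).
      rewrite listed_delta // -xyq'' lte_fin.
      apply: (@le_lt_trans _ _ (alpha * (eps * l (edge q)))).
        by rewrite ler_wpM2l.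
      by rewrite mulrA gtr_pMl.
    rewrite xyq''; apply: dist_set2_le (@run_l_gt0 r1) xyq'' _.
    by rewrite -listed_delta // run_stretch.
  - by rewrite lee_fin ler_wpM2l.
have d3 : (dist l (run r1) q'.1 q'.2 <= (l (edge q))%:E)%E.
  apply: le_trans (_ : (l (edge q'))%:E <= _)%E.
    apply: dist_edge_le; last exact: added_light_in_run sE q'A q'r1.
    by apply: adj_neq simpleE _; apply: (fintype.subsetP sE'E).
  by rewrite -!light_dist //; apply: earlier_dist sE q'r1.
have d2' := dist_sym_le (@run_l_gt0 r1) (near _ _ d2).
have := dist_le_trans (@run_l_gt0 r1) (near _ _ d1)
  (dist_le_trans (@run_l_gt0 r1) d3 d2').
rewrite leNgt => /negP; apply; apply: le_lt_trans dq; rewrite lee_fin.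
have := ler_wpM2r (ltW l0) eps2; nra.
Qed.

End GreedyRun.

(** * The bounds *)

(** With [a] the term [Num.sqrt n%:R * p%:R], the opposite inequality gives [a < m - n] and [a < m],
    so [a ^ 2 < m * (m - n) <= n * p ^ 2 = a ^ 2]. *)
Lemma le_of_sqr_le (R : realType) (m n p : nat) :
  (m ^ 2 <= n * (p ^ 2 + m))%N ->
  m%:R <= n%:R + Num.sqrt n%:R * p%:R :> R.
Proof.
rewrite -(ler_nat R) natrX natrM natrD natrX => mnp.
rewrite leNgt; apply/negP => lt_m.
have a0 : 0 <= Num.sqrt n%:R * p%:R :> R by rewrite mulr_ge0 ?sqrtr_ge0 ?ler0n.
have n0 : 0 <= n%:R :> R by rewrite ler0n.
have aE : (Num.sqrt n%:R * p%:R) ^+ 2 = n%:R * p%:R ^+ 2 :> R by rewrite exprMn sqr_sqrtr.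
move: a0 lt_m aE mnp; set a := Num.sqrt _ * _ => a0 lt_m aE mnp.
have : a * a < m%:R * (m%:R - n%:R) by apply: ltr_pM => //; lra.
rewrite -expr2 aE; lra.
Qed.

Lemma le_of_moore (R : realType) (m n k : nat) : (0 < n)%N -> (0 < k)%N ->
  ((m %/ n) ^ k <= n)%N -> m%:R <= n%:R `^ (1 + k%:R^-1) + n%:R :> R.
Proof.
move=> n0 k0 moore; have n0R : 0 < n%:R :> R by rewrite ltr0n.
rewrite powRD; last by rewrite (gt_eqF n0R) implybT.
rewrite powRr1 ?ler0n // -{3}(mulr1 n%:R) -mulrDr.
have root_le : (m %/ n)%:R <= n%:R `^ k%:R^-1 :> R.
  have -> : (m %/ n)%:R = ((m %/ n)%:R `^ k%:R) `^ k%:R^-1 :> R.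
    by rewrite -powRrM divff ?pnatr_eq0 -?lt0n // powRr1 ?ler0n.
  apply: ge0_ler_powR; rewrite ?nnegrE ?invr_ge0 ?ler0n ?powR_ge0 //.
  by rewrite powR_mulrn ?ler0n // -natrX ler_nat.
apply: le_trans (_ : n%:R * (m %/ n).+1%:R <= _); last first.
  by rewrite ler_pM2l // -natr1 lerD2r.
by rewrite -natrM ler_nat mulnC ltnW // ltn_ceil.
Qed.

Lemma simple_graph_nonempty (V : finType) (E : {set {set V}}) e :
  simple_graph E -> e \in E -> (0 < #|V|)%N.
Proof.
move=> /fintype.forall_inP sE /sE/eqP e2.
by apply: leq_trans (max_card (mem e)); rewrite e2.
Qed.

Section AugmentedGreedy.
Variables (F : realFieldType) (V : finType) (E : {set {set V}}).
Variables (w l : {set V} -> F) (alpha what : F) (H : {set {set V}}).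
Hypotheses (inst : spanner_instance E w l) (alpha_ge1 : 1 <= alpha).
Let delta := mult_demand E l alpha.
Hypothesis aug : augmented_greedy E (metric_edges E l) w l delta what H.
Let E' := edges_le E w what.

Let alpha_ge0 : 0 <= alpha. Proof. exact: le_trans alpha_ge1. Qed.

Lemma augmented_card_gt0 : (0 < #|V|)%N.
Proof.
have [sE _ _ _] := inst; have [x [T [[[e eE _] _ _] _ _ _]]] := aug.
exact: simple_graph_nonempty sE eE.
Qed.

Lemma threshold_feasible : feasible E l delta E'.
Proof.
have [x [T [[_ fx _] _ whatE _]]] := aug; apply: feasible_mono fx.
  apply/fintype.subsetP => e; rewrite !finset.inE => /andP[-> /le_trans]; apply.
  by rewrite whatE le_max lexx.
by apply/fintype.subsetP => e; rewrite finset.inE => /andP[].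
Qed.

Lemma threshold_ge0 : 0 <= what.
Proof.
have [_ _ w0 _] := inst; have [x [T [[[e eE <-] _ _] _ -> _]]] := aug.
by rewrite le_max w0.
Qed.

Lemma final_threshold_le_OPT : what <= OPT E w l delta.
Proof.
by have [x [T [xmin Tmin -> _]]] := aug; apply: threshold_le_OPT xmin Tmin.
Qed.

Lemma augmented_run : exists pi s, [/\ tie_breaking l E' pi,
    processing_order E' (metric_edges E l) l s
  & H = foldl (greedy_step l delta pi) finset.set0 s].
Proof. by have [x [T [_ _ _]]] := aug. Qed.

Lemma augmented_feasible : feasible E l delta H.
Proof.
have [sE cE _ l0] := inst; have [pi [s [tb ord ->]]] := augmented_run.
exact: (run_feasible sE cE l0 threshold_feasible tb ord alpha_ge0).
Qed.

Lemma augmented_weight_le : weight w H <= #|H|%:R * OPT E w l delta.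
Proof.
have [sE cE _ l0] := inst; have [pi [s [tb ord HE]]] := augmented_run.
have sHE' : H \subset E'.
  by rewrite HE (run_sub cE l0 threshold_feasible tb).
apply: le_trans (weight_le_card sHE') _.
by rewrite ler_wpM2l ?ler0n ?final_threshold_le_OPT.
Qed.

Lemma OPT_ge0 : 0 <= OPT E w l delta.
Proof. exact: le_trans threshold_ge0 final_threshold_le_OPT. Qed.

Lemma augmented_card (R : realType) pi s : tie_breaking l E' pi ->
  processing_order E' (metric_edges E l) l s ->
  H = foldl (greedy_step l delta pi) finset.set0 s ->
  #|H|%:R <= #|[set [set q.1; q.2] | q in added_light E E' l alpha pi s]|%:R +
    (#|V|%:R + Num.sqrt #|V|%:R * #|heavy_edges E w what|%:R) :> R.
Proof.
have [sE cE _ l0] := inst; move=> tb ord HE; have fE' := threshold_feasible.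
have [U UQ] := run_card sE cE l0 fE' tb ord; rewrite -HE => HU.
have cE' := feasible_connected l0 cE fE'.
have cU := le_of_sqr_le R (selected_union_card cE' tb UQ).
have := heavy_pairs_size ord; rewrite -(ler_nat R) => hp.
move: HU; rewrite -(ler_nat R) natrD => /le_trans; apply.
by rewrite lerD2l (le_trans cU) // lerD2l ler_wpM2l ?sqrtr_ge0.
Qed.

End AugmentedGreedy.

Lemma augmented_greedy_girth (R : realType) (k : nat) (V : finType)
    (E : {set {set V}}) (w l : {set V} -> rat) (what : rat)
    (H : {set {set V}}) : (1 <= k)%N -> spanner_instance E w l ->
  augmented_greedy E (metric_edges E l) w l
    (mult_demand E l (2 * k%:R - 1)) what H ->
  #|H|%:R <= 3 * (#|V|%:R `^ (1 + k%:R^-1) +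
    Num.sqrt #|V|%:R * #|heavy_edges E w what|%:R) :> R.
Proof.
move=> k1 inst aug; have [sE cE _ l0] := inst.
have fE' := threshold_feasible aug; have n0 := augmented_card_gt0 inst aug.
have [pi [s [tb ord HE]]] := augmented_run aug.
have := augmented_card inst aug R tb ord HE.
set A := added_light _ _ _ _ _ _; set L := [set _ | q in A].
have sL : simple_graph L.
  apply/fintype.forall_inP => _ /imsetP[q qA ->].
  have [qE' _] := added_lightP qA; apply: (fintype.forall_inP sE).
  by case/andP: fE' => /fintype.subsetP sE' _; apply: sE'.
have girthL c : ucycle (adj L) c -> (size c <= 2)%N || (2 * k < size c)%N.
  apply: (added_light_no_short_cycle sE cE l0 fE' tb ord).
  by rewrite natrM.
have cL := le_of_moore R n0 k1 (moore_bound sL girthL k1).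
(* Two terms [#|V|] have to be absorbed, one from rounding in the Moore bound and one from the union
   of paths; with the Moore term itself this makes the constant 3. *)
have n_le : #|V|%:R <= #|V|%:R `^ (1 + k%:R^-1) :> R.
  rewrite -{1}(@powRr1 R #|V|%:R) ?ler0n // ler_powR ?ler1n //.
  by rewrite lerDl invr_ge0 ler0n.
have h0 : 0 <= Num.sqrt #|V|%:R * #|heavy_edges E w what|%:R :> R.
  by rewrite mulr_ge0 ?sqrtr_ge0 ?ler0n.
by lra.
Qed.

Lemma geometric_dist_le (R : realType) (d : nat) (V : finType)
    (pt : V -> 'rV[R]_d) (E : {set {set V}}) (l : {set V} -> R) u v :
  geometric_instance pt E l ->
  (dist l E u v <= (d.+1%:R * sup_dist (pt u) (pt v))%:E)%E.
Proof.
move=> [EE lE]; have [->|uv] := eqVneq u v.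
  by rewrite dist_le0 // mulr_ge0 ?sup_dist_ge0.
have uvE : [set u; v] \in E by rewrite EE finset.inE cards2 uv.
apply: le_trans (dist_edge_le l uv uvE) _.
by rewrite lE // lee_fin euclid_le_sup_dist.
Qed.

Lemma augmented_greedy_geometric (R : realType) (d : nat) (alpha : R) :
  1 < alpha -> exists C : R,
    forall (V : finType) (pt : V -> 'rV[R]_d) (E : {set {set V}})
      (w l : {set V} -> R) (what : R) (H : {set {set V}}),
    spanner_instance E w l -> geometric_instance pt E l ->
    augmented_greedy E (metric_edges E l) w l (mult_demand E l alpha) what H ->
    #|H|%:R <= C * (#|V|%:R +
      Num.sqrt #|V|%:R * #|heavy_edges E w what|%:R).
Proof.
move=> alpha1; have alpha0 : 0 < alpha by apply: lt_trans alpha1.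
(* The first term yields [1 + 2 * alpha * eps <= alpha], the second [alpha * eps <= 1 / 2]: the two
   smallness conditions of [added_light_gap]. *)
pose eps := Order.min ((alpha - 1) / (2 * alpha)) (1 / (2 * alpha)).
have a2 : 0 < 2 * alpha by rewrite mulr_gt0.
have eps0 : 0 < eps by rewrite /eps lt_min !divr_gt0 ?subr_gt0.
have eps1 : eps * (2 * alpha) <= alpha - 1.
  by rewrite -ler_pdivlMr // /eps ge_min lexx.
have eps2 : eps * (2 * alpha) <= 1.
  by rewrite -ler_pdivlMr // /eps ge_min lexx orbT.
(* Dividing by [d.+1] pays for passing from the sup distance to Euclidean lengths. *)
have [|N cN] := @gap_pairs_card R d (eps / d.+1%:R); first by rewrite divr_gt0.
exists (N%:R + 1) => V pt E w l what H inst geo aug.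
have [sE cE _ l0] := inst; have [EE lE] := geo.
have fE' := threshold_feasible aug.
have [pi [s [tb ord HE]]] := augmented_run aug.
have := augmented_card inst aug R tb ord HE.
set A := added_light _ _ _ _ _ _ => cH.
have pt_inj : injective pt.
  move=> u v puv; apply/eqP/negPn/negP => uv.
  have uvE : [set u; v] \in E by rewrite EE finset.inE cards2 uv.
  have := l0 _ uvE; rewrite lE // puv /euclid_dist.
  rewrite big1 ?sqrtr0 ?ltxx // => i _; by rewrite subrr expr0n.
have A_neq q : q \in A -> q.1 != q.2.
  move=> /added_lightP[qE' _]; apply: (adj_neq sE).
  by case/andP: fE' => /fintype.subsetP sE' _; apply: sE'.
have sup_le q : q \in A -> sup_dist (pt q.1) (pt q.2) <= l [set q.1; q.2].
  by move=> qA; rewrite lE ?A_neq // sup_dist_le_euclid.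
have near q u v : q \in A -> sup_dist (pt u) (pt v) <=
      eps / d.+1%:R * sup_dist (pt q.1) (pt q.2) ->
    (dist l E u v <= (eps * l [set q.1; q.2])%:E)%E.
  move=> qA uv; apply: le_trans (geometric_dist_le u v geo) _; rewrite lee_fin.
  apply: le_trans (_ : eps * sup_dist (pt q.1) (pt q.2) <= _); last first.
    by rewrite ler_pM2l // sup_le.
  apply: le_trans (ler_wpM2l (ler0n _ _) uv) _.
  by rewrite mulrA mulrCA divff ?mulr1 ?pnatr_eq0.
have A_gap q q' : q \in A -> q' \in A ->
    sup_dist (pt q.1) (pt q'.1) <= eps / d.+1%:R * sup_dist (pt q.1) (pt q.2) ->
    sup_dist (pt q.2) (pt q'.2) <= eps / d.+1%:R * sup_dist (pt q.1) (pt q.2) ->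
    q = q'.
  move=> qA q'A /(near q _ _ qA) d1 /(near q _ _ qA) d2; apply/eqP/negPn/negP => qq'.
  have qs := added_light_listed qA; have q's := added_light_listed q'A.
  have [r1 [r2 sq]] := mem_cat_split qs.
  have gap := added_light_gap sE cE l0 fE' tb ord (ltW alpha0) (eps := eps).
  have gap1 : alpha * eps < 1 by lra.
  have gap2 : 1 + 2 * alpha * eps <= alpha by lra.
  move: (q's); rewrite {1}sq mem_cat in_cons eq_sym (negPf qq') /= => /orP[q'r1|q'r2].
    exact: (gap _ _ _ _ gap1 gap2 sq qA q'A q'r1 d1 d2).
  have [r3 [r4 r2E]] := mem_cat_split q'r2.
  have sq' : s = (r1 ++ q :: r3) ++ q' :: r4 by rewrite sq r2E -catA.
  have qr : q \in r1 ++ q :: r3 by rewrite mem_cat mem_head orbT.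
  (* Here [q'] is the later pair, so the roles are exchanged. Closeness was measured against the
     length of [q], which is at most that of [q']. *)
  have le_l : l [set q.1; q.2] <= l [set q'.1; q'.2].
    have [qE' _] := added_lightP qA; have [q'E' _] := added_lightP q'A.
    rewrite -lee_fin -(light_dist sE l0 fE' ord qs qE').
    rewrite -(light_dist sE l0 fE' ord q's q'E').
    exact: (earlier_dist ord sq' qr).
  have widen u v : (dist l E u v <= (eps * l [set q.1; q.2])%:E)%E ->
      (dist l E v u <= (eps * l [set q'.1; q'.2])%:E)%E.
    move=> uv; apply: dist_sym_le => //; apply: le_trans uv _.
    by rewrite lee_fin ler_pM2l.
  exact: (gap _ _ _ _ gap1 gap2 sq' q'A qA qr (widen _ _ d1) (widen _ _ d2)).
have cA := cN V pt A pt_inj A_neq A_gap.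
have : #|[set [set q.1; q.2] | q in A]|%:R <= #|V|%:R * N%:R :> R.
  by rewrite -natrM ler_nat (leq_trans (leq_imset_card _ _)).
have h0 : 0 <= Num.sqrt #|V|%:R * #|heavy_edges E w what|%:R :> R.
  by rewrite mulr_ge0 ?sqrtr_ge0 ?ler0n.
have := mulr_ge0 (ler0n R N) h0; nra.
Qed.

Theorem lemma4 (R : realType) :
  (exists C : R,
     forall (k : nat) (V : finType) (E : {set {set V}})
       (w l : {set V} -> rat) (what : rat) (H : {set {set V}}),
     (1 <= k)%N ->
     spanner_instance E w l ->
     let delta := mult_demand E l (2 * k%:R - 1) in
     augmented_greedy E (metric_edges E l) w l delta what H ->
     let bound : R := (#|V|%:R `^ (1 + k%:R^-1)) +
       Num.sqrt #|V|%:R * #|heavy_edges E w what|%:R in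
     [/\ feasible E l delta H,
         #|H|%:R <= C * bound
       & ratr (weight w H) <= C * bound * ratr (OPT E w l delta)])
  /\
  (forall (d : nat) (alpha : R), 1 < alpha ->
     exists C : R,
     forall (V : finType) (pt : V -> 'rV[R]_d) (E : {set {set V}})
       (w l : {set V} -> R) (what : R) (H : {set {set V}}),
     spanner_instance E w l ->
     geometric_instance pt E l ->
     let delta := mult_demand E l alpha in
     augmented_greedy E (metric_edges E l) w l delta what H ->
     let bound : R := #|V|%:R +
       Num.sqrt #|V|%:R * #|heavy_edges E w what|%:R in
     [/\ feasible E l delta H,
         #|H|%:R <= C * bound
       & weight w H <= C * bound * OPT E w l delta]).
Proof.
split=> [|d alpha alpha1].
  exists 3 => k V E w l what H k1 inst delta aug bound.
  have alpha1 : 1 <= 2 * k%:R - 1 :> rat.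
    by have : 1 <= k%:R :> rat; [rewrite ler1n|lra].
  have cH := augmented_greedy_girth R k1 inst aug.
  split; [exact: augmented_feasible inst alpha1 aug|exact: cH|].
  apply: le_trans (_ : #|H|%:R * ratr (OPT E w l delta) <= _).
    rewrite -(ratr_nat R) -rmorphM ler_rat.
    exact: augmented_weight_le inst alpha1 aug.
  by rewrite ler_wpM2r // -(rmorph0 (ratr : rat -> R)) ler_rat (OPT_ge0 inst alpha1 aug).
have [C cC] := augmented_greedy_geometric d alpha1.
exists C => V pt E w l what H inst geo delta aug bound.
have cH := cC V pt E w l what H inst geo aug.
split; [exact: augmented_feasible inst (ltW alpha1) aug|exact: cH|].
apply: le_trans (augmented_weight_le inst (ltW alpha1) aug) _.
by rewrite ler_wpM2r // (OPT_ge0 inst (ltW alpha1) aug).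
Qed.
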